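(* Let $n\geq 3$ be an integer and $\mathbb{K}$ be a commutative field with $\#\mathbb{K}>n$. Let $U$ and $V$ be finite-dimensional $\mathbb{K}$-vector spaces, let $\mathcal{S}$ be an $(n+1)$-dimensional reduced LLD subspace of $\mathcal{L}(U,V)$, and let $\mathcal{H}$ be a (linear) hyperplane of $\mathcal{S}$ such that $\operatorname{mrk}\mathcal{H}=2n-2$. Then: (a) $\mathcal{S}$ is equivalent to the twisted operator space $\mathcal{T}_A$ attached to some $(n-1)$-dimensional LDB division algebra $A$ over $\mathbb{K}$; (b) the LDB division algebra $A$ is uniquely determined by $\mathcal{S}$ up to weak equivalence (i.e. if $\mathcal{S}$ is equivalent to both $\mathcal{T}_A$ and $\mathcal{T}_B$, for LDB division algebras $A$ and $B$, then $A$ and $B$ are weakly equivalent); (c) the operator space $\mathcal{H}$ is equivalent to a non-isotropic hyperplane of $\mathcal{T}_A$; (d) if $n\geq 4$, then $\mathcal{S}$ is the reflexive closure of $\mathcal{H}$, and the weak equivalence class of the LDB division algebra $A$ depends only on $\mathcal{H}$.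
   Context: $\mathcal{L}(U,V)$ is the space of all linear operators from $U$ to $V$. A finite-dimensional linear subspace $\mathcal{S}$ of $\mathcal{L}(U,V)$ is locally linearly dependent (LLD) when for every $x\in U$ there is a non-zero $f\in\mathcal{S}$ with $f(x)=0$. It is reduced when $\bigcap_{f\in\mathcal{S}}\operatorname{Ker} f=\{0\}$ and $\sum_{f\in\mathcal{S}}\operatorname{Im} f=V$. The minimal rank $\operatorname{mrk}\mathcal{H}$ is the smallest rank of a non-zero (finite rank) operator in $\mathcal{H}$. The reflexive closure of $\mathcal{H}$ is the set of all $g\in\mathcal{L}(U,V)$ with $g(x)\in\{f(x)\mid f\in\mathcal{H}\}$ for all $x\in U$. Equivalence: linear subspaces $\mathcal{S}\subset\mathcal{L}(U,V)$ and $\mathcal{S}'\subset\mathcal{L}(U',V')$ are equivalent when there are linear isomorphisms $F:U\to U'$ and $G:V'\to V$ such that $\mathcal{S}=\{G\circ g\circ F\mid g\in\mathcal{S}'\}$. LDB division algebras: a bilinear map $\star:A\times A\to A$ is regular when $a\star b\neq 0$ for all non-zero $a,b\in A$. A finite-dimensional division algebra $(A,\star)$ over $\mathbb{K}$ is a finite-dimensional $\mathbb{K}$-vector space $A$ with a regular bilinear map $\star:A\times A\to A$ (no associativity or unit is required). A quasi-left-inversion of $\star$ is a map $\bullet:A\times A\to A$ such that $x\bullet y=0$ if and only if $x=0$ or $y=0$, and such that for all $(x,y)\in A^2$ the vectors $x\star(x\bullet y)$ and $y$ are collinear (linearly dependent). An LDB division algebra is a triple $(A,\star,\bullet)$ where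 $(A,\star)$ is a finite-dimensional division algebra of positive dimension and $\bullet$ is a bilinear quasi-left-inversion of $\star$. For such a triple there is a unique quadratic form $q$ on $A$ with $x\star(x\bullet y)=q(x)\,y$ for all $(x,y)\in A^2$, called the attached quadratic form. Weak equivalence: LDB division algebras $(A,\star,\bullet)$ and $(B,\star',\bullet')$ are weakly equivalent when there are linear isomorphisms $f:B\to A$, $g:B\to A$, $h:A\to B$ such that $x\star' y=h(f(x)\star g(y))$ for all $(x,y)\in B^2$. Twisted operator space: $\mathcal{T}_A=\mathcal{T}_{A,\star,\bullet}\subset\mathcal{L}(A^2)$ is the vector space of all endomorphisms $\Gamma_A(x+(\lambda,\mu),-):(y,z)\mapsto(x\star z+\lambda y,\;x\bullet y+\mu z)$ of $A^2$, with $(x,\lambda,\mu)\in A\times\mathbb{K}^2$. The map $x+(\lambda,\mu)\mapsto\Gamma_A(x+(\lambda,\mu),-)$ is a linear isomorphism from $A\oplus\mathbb{K}^2$ to $\mathcal{T}_A$, through which $\mathcal{T}_A$ is endowed with the quadratic form $\widetilde{q}:x+(\lambda,\mu)\mapsto q(x)-\lambda\mu$. A hyperplane of $\mathcal{T}_A$ is non-isotropic when $\widetilde{q}$ vanishes at no non-zero vector of it. *)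

(* Defs.v *)
From HB Require Import structures.
From mathcomp Require Import all_boot all_algebra.
Set Implicit Arguments.
Unset Strict Implicit.
Unset Printing Implicit Defensive.
Import GRing.Theory.
Local Open Scope ring_scope.

Section OperatorSpaces.
Variables (K : fieldType) (U V : vectType K).
Implicit Types (S H : {vspace 'Hom(U, V)}) (f g : 'Hom(U, V)).

Definition LLD S : Prop :=
  forall x : U, exists f, [/\ f \in S, f != 0 & f x = 0].

(* The second component says that every vector is a finite sum of vectors f u
   with f in S, i.e., that the images of the operators in S sum to V. *)
Definition reduced S : Prop :=
  (forall x : U, (forall f, f \in S -> f x = 0) -> x = 0) /\
  (forall v : V, exists s : seq ('Hom(U, V) * U),
     (forall p, p \in s -> p.1 \in S) /\ v = \sum_(p <- s) p.1 p.2).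

Definition lrank f : nat := \dim (limg f).

Definition has_mrk H (r : nat) : Prop :=
  (exists f, [/\ f \in H, f != 0 & lrank f = r]) /\
  (forall f, f \in H -> f != 0 -> (r <= lrank f)%N).

Definition in_reflexive_closure H g : Prop :=
  forall x : U, exists2 f, f \in H & g x = f x.

Definition is_reflexive_closure S H : Prop :=
  forall g, g \in S <-> in_reflexive_closure H g.

End OperatorSpaces.

Definition hyperplane_of (K : fieldType) (W : vectType K) (S H : {vspace W}) :=
  (H <= S)%VS && (\dim S == (\dim H).+1).

Definition equivalent (K : fieldType) (U V U' V' : vectType K)
    (S : {vspace 'Hom(U, V)}) (S' : {vspace 'Hom(U', V')}) : Prop :=
  exists (F : 'Hom(U, U')) (G : 'Hom(V', V)),
    [/\ bijective F, bijective G &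
      forall f, f \in S <-> exists2 g, g \in S' & f = (G \o g \o F)%VF].

Definition collinear (K : fieldType) (W : vectType K) (u v : W) : bool :=
  ~~ free [:: u; v].

Definition regular (K : fieldType) (A : vectType K) (op : A -> A -> A) : Prop :=
  forall a b, a != 0 -> b != 0 -> op a b != 0.

Definition quasi_left_inversion (K : fieldType) (A : vectType K)
    (op inv : A -> A -> A) : Prop :=
  (forall x y, inv x y = 0 <-> x = 0 \/ y = 0) /\
  (forall x y, collinear (op x (inv x y)) y).

Record LDBAlgebra (K : fieldType) := LDBAlgebra_Build {
  ldb_sort :> vectType K;
  ldb_star : {bilinear ldb_sort -> ldb_sort -> ldb_sort};
  ldb_bullet : {bilinear ldb_sort -> ldb_sort -> ldb_sort};
  ldb_dim_gt0 : (0 < \dim {:ldb_sort})%N;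
  ldb_star_regular : regular ldb_star;
  ldb_bullet_qli : quasi_left_inversion ldb_star ldb_bullet }.

Arguments ldb_star {K A} : rename.
Arguments ldb_bullet {K A} : rename.

Definition weakly_equivalent (K : fieldType) (A B : LDBAlgebra K) : Prop :=
  exists (f g : 'Hom(B, A)) (h : 'Hom(A, B)),
    [/\ bijective f, bijective g, bijective h &
      forall x y : B, ldb_star x y = h (ldb_star (f x) (g y))].

Definition quadratic_form (K : fieldType) (W : vectType K) (q : W -> K) : Prop :=
  exists b : {biscalar W}, forall x, q x = b x x.

Section LDB.
Variables (K : fieldType) (A : LDBAlgebra K).
Implicit Types (x y z : A) (l m : K).

(* The coordinate of x * (x . v) along one fixed nonzero vector v; it does not
   depend on v, see ldb_qformP. *)
Definition ldb_qform x : K :=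
  coord [tuple vpick {:A}] ord0
    (ldb_star x (ldb_bullet x (vpick {:A}))).

Lemma ldb_vpick_neq0 : vpick {:A} != 0.
Proof. by rewrite vpick0 -dimv_eq0 -lt0n ldb_dim_gt0. Qed.

Lemma ldb_collinear x y :
  exists k, ldb_star x (ldb_bullet x y) = k *: y.
Proof.
have [->|y0] := eqVneq y 0; first by exists 0; rewrite !linear0.
have := (ldb_bullet_qli A).2 x y.
rewrite /collinear free_cons seq1_free y0 andbT negbK span_seq1.
by move=> /vlineP.
Qed.

Lemma ldb_qformP x y :
  ldb_star x (ldb_bullet x y) = ldb_qform x *: y.
Proof.
have v0 := ldb_vpick_neq0; rewrite /ldb_qform.
set v := vpick _ in v0 *.
have [k kE] := ldb_collinear x v.
have -> : coord [tuple v] ord0 (ldb_star x (ldb_bullet x v)) = k.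
  rewrite kE linearZ /=.
  have /(coord_free ord0 ord0) : free [tuple v] by rewrite seq1_free.
  by rewrite /= => ->; rewrite mulr1.
have [j jE] := ldb_collinear x y.
have [l lE] := ldb_collinear x (v + y).
have [/vlineP[c ->]|yv] := boolP (y \in <[v]>%VS).
  by rewrite !linearZ /= kE !scalerA mulrC.
move: lE; rewrite !linearD /= kE jE => /eqP.
rewrite -subr_eq0 opprD addrACA -!scalerBl => /eqP lE.
have jl : j = l.
  apply/eqP; rewrite -subr_eq0; apply: contraNT yv => jl.
  apply/vlineP; exists (- (j - l)^-1 * (k - l)).
  apply: (scalerI jl); rewrite scalerA mulrA mulrN divff // mulN1r scaleNr.
  by apply/eqP; rewrite -addr_eq0 addrC lE.
move: lE; rewrite -jl subrr scale0r addr0 => /eqP.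
by rewrite scaler_eq0 (negPf v0) orbF subr_eq0 => /eqP ->.
Qed.

Lemma ldb_qform_uniq (q : A -> K) :
  (forall x y, ldb_star x (ldb_bullet x y) = q x *: y) -> q =1 ldb_qform.
Proof.
move=> qP x; have := qP x (vpick {:A}); rewrite ldb_qformP => /eqP.
rewrite -subr_eq0 -scalerBl scaler_eq0 (negPf ldb_vpick_neq0) orbF subr_eq0.
by move=> /eqP.
Qed.

Definition ldb_polar x y : K :=
  coord [tuple vpick {:A}] ord0
    (ldb_star x (ldb_bullet y (vpick {:A}))).

Fact ldb_polar_bilinear :
  bilinear_for (GRing.Scale.Law.clone _ _ *%R _)
    (GRing.Scale.Law.clone _ _ *%R _) ldb_polar.
Proof.
split=> u c x y; rewrite /ldb_polar.
  by rewrite linearPl linearP.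
by rewrite linearPl linearPr linearP.
Qed.
HB.instance Definition _ :=
  bilinear_isBilinear.Build K A A K *%R *%R ldb_polar ldb_polar_bilinear.

Lemma ldb_qform_quadratic : quadratic_form ldb_qform.
Proof. by exists ldb_polar. Qed.

Definition twisted_fun x l m (p : A * A) : A * A :=
  (ldb_star x p.2 + l *: p.1, ldb_bullet x p.1 + m *: p.2).

Fact twisted_fun_linear x l m : linear (twisted_fun x l m).
Proof.
move=> c [a b] [a' b']; apply/pair_equal_spec; split=> /=.
  by rewrite linearPr !scalerDr !scalerA [l * c]mulrC addrACA.
by rewrite linearPr !scalerDr !scalerA [m * c]mulrC addrACA.
Qed.
HB.instance Definition _ x l m :=
  GRing.isLinear.Build K (A * A)%type (A * A)%type *:%R (twisted_fun x l m)
    (twisted_fun_linear x l m).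

Definition twisted_op x l m : 'Hom((A * A)%type, (A * A)%type) :=
  linfun (twisted_fun x l m).

Lemma twisted_opE x l m y z :
  twisted_op x l m (y, z) =
    (ldb_star x z + l *: y, ldb_bullet x y + m *: z).
Proof. by rewrite lfunE. Qed.

Definition twisted_map (w : A * (K^o * K^o)) :=
  twisted_op w.1 w.2.1 w.2.2.

Fact twisted_map_linear : linear twisted_map.
Proof.
move=> c [x [l m]] [x' [l' m']]; apply/lfunP => -[y z].
rewrite add_lfunE scale_lfunE !twisted_opE; apply/pair_equal_spec; split=> /=.
  by rewrite linearPl scalerDl scalerDr scalerA addrACA.
by rewrite linearPl scalerDl scalerDr scalerA addrACA.
Qed.
HB.instance Definition _ :=
  GRing.isLinear.Build K (A * (K^o * K^o))%type
    'Hom((A * A)%type, (A * A)%type) *:%R twisted_map twisted_map_linear.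

Definition twisted_space : {vspace 'Hom((A * A)%type, (A * A)%type)} :=
  limg (linfun twisted_map).

Lemma twisted_spaceP (f : 'Hom((A * A)%type, (A * A)%type)) :
  f \in twisted_space <-> exists x l m, f = twisted_op x l m.
Proof.
split=> [/memv_imgP[[x [l m]] _ ->]|[x [l [m ->]]]].
  by exists x, l, m; rewrite lfunE.
have -> : twisted_op x l m = linfun twisted_map (x, (l, m)) by rewrite lfunE.
exact: memv_img (memvf _).
Qed.

Definition twisted_qform x l m : K := ldb_qform x - l * m.

Lemma twisted_op_inj x l m x' l' m' :
  twisted_op x l m = twisted_op x' l' m' -> [/\ x = x', l = l' & m = m'].
Proof.
move=> E; have v0 := ldb_vpick_neq0; set v := vpick _ in v0.
have := congr1 (fun f : 'Hom(_, _) => f (v, 0)) E.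
have := congr1 (fun f : 'Hom(_, _) => f (0, v)) E.
rewrite !twisted_opE !linear0 !addr0 !add0r => -[sE mE] [lE _].
have scI (a b : K) : a *: v = b *: v -> a = b.
  move/eqP; rewrite -subr_eq0 -scalerBl scaler_eq0 (negPf v0) orbF subr_eq0.
  by move/eqP.
split; [|exact: scI lE|exact: scI mE].
apply/eqP; rewrite -subr_eq0; apply: contraTT isT => xx'.
have := ldb_star_regular xx' v0.
by rewrite linearBl /= sE subrr eqxx.
Qed.

(* By twisted_op_inj the parameters (x, l, m) are determined by the operator,
   so twisted_qform is a well-defined form on the twisted operator space. *)
Definition non_isotropic (H : {vspace 'Hom((A * A)%type, (A * A)%type)}) : Prop :=
  forall x l m, twisted_op x l m \in H -> twisted_op x l m != 0 ->
    twisted_qform x l m != 0.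

End LDB.

Arguments twisted_space {K} A.
Arguments non_isotropic {K} A H.

Definition equiv_non_isotropic_hyperplane (K : fieldType) (U V : vectType K)
    (H : {vspace 'Hom(U, V)}) (A : LDBAlgebra K) : Prop :=
  exists H' : {vspace 'Hom((A * A)%type, (A * A)%type)},
    [/\ hyperplane_of (twisted_space A) H', non_isotropic A H' &
      equivalent H H'].

Definition card_gt (T : eqType) (n : nat) : Prop :=
  exists s : seq T, uniq s && (n < size s)%N.

(* Main.v *)
(* Write S x for {h x | h in S} and let x be generic, i.e. dim (S x) maximal. If w lies in
   S (y + t x) for all t then w lies in S x: a determinant that is a monic
   polynomial of degree dim (S x) in t would otherwise vanish on all of K.
   Applied to f in S with f x = 0, this gives f y in S x; h y in S x whenever
   h x = f y; and k y in S x whenever moreover k x = h y.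
   Under the minimal rank hypothesis these relations force dim (S x) = n and
   rank f = n - 1, and two independent such operators f, g satisfy
   U = ker f + ker g and V = im f + im g, both sums being direct. In these
   decompositions every h in S has scalar diagonal blocks (multiples of f and g),
   and the off-diagonal blocks are the two products of an LDB division algebra.
   For uniqueness, an isotropic f recovers the product up to isotopy as the
   bilinear map (f^perp / f) x ker f -> im f. For the reflexive closure, two
   different extensions S, S1 of H would contain operators killing x with
   the same kernel and with images meeting in dimension n - 2 > 0, which forces
   them to be proportional. *)
From HB Require Import structures.
Require Import Defs.
From mathcomp Require Import all_boot all_algebra.
From mathcomp Require Import ssrAC zify ring.
Set Implicit Arguments.
Unset Strict Implicit.
Unset Printing Implicit Defensive.
Import GRing.Theory.

(** * Values at a generic vector *)

Lemma capv_line (K : fieldType) (L : vectType K) (W : {vspace L}) (v : L) :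
  v \notin W -> (W :&: <[v]> = 0)%VS.
Proof.
move=> vW; apply/eqP; rewrite -subv0.
apply/subvP => w /memv_capP[wW /vlineP[c wE]].
rewrite memv0 wE; have [->|c0] := eqVneq c 0%R; first by rewrite scale0r.
move: wW; rewrite wE => /(memvZ c^-1%R); rewrite scalerA mulVf // scale1r.
by rewrite (negPf vW).
Qed.

Section Values.
Local Open Scope ring_scope.
Variables (K : fieldType) (U V : vectType K).
Implicit Types (S T H : {vspace 'Hom(U, V)}) (f g h k : 'Hom(U, V)) (x y : U).

Definition eval_at x f := f x.
Fact eval_at_linear x : linear (eval_at x).
Proof. by move=> c f g; rewrite /eval_at add_lfunE scale_lfunE. Qed.
HB.instance Definition _ x :=
  GRing.isLinear.Build K 'Hom(U, V) V *:%R (eval_at x) (eval_at_linear x).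

Definition values T x : {vspace V} := (linfun (eval_at x) @: T)%VS.

Lemma valuesP T x v : reflect (exists2 h, h \in T & v = h x) (v \in values T x).
Proof.
by apply: (iffP memv_imgP) => -[h hT ->]; exists h => //; rewrite lfunE.
Qed.

Lemma mem_values T x h : h \in T -> h x \in values T x.
Proof. by move=> hT; apply/valuesP; exists h. Qed.

Lemma values_le T x : (\dim (values T x) <= \dim T)%N.
Proof. by rewrite -(limg_ker_dim (linfun (eval_at x)) T) leq_addl. Qed.

Lemma values_lt T x f :
  f \in T -> f != 0 -> f x = 0 -> (\dim (values T x) < \dim T)%N.
Proof.
move=> fT f0 fx; rewrite -(limg_ker_dim (linfun (eval_at x)) T) -add1n leq_add2r.
have <- : \dim <[f]> = 1%N by rewrite dim_vline f0.
apply: dimvS; rewrite -memvE memv_cap fT memv_ker lfunE /=.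
by rewrite /eval_at fx.
Qed.

Lemma values_gt T x :
  (\dim (values T x) < \dim T)%N -> exists f, [/\ f \in T, f != 0 & f x = 0].
Proof.
rewrite -(limg_ker_dim (linfun (eval_at x)) T) -add1n leq_add2r.
rewrite lt0n dimv_eq0 -vpick0 => f0; exists (vpick (T :&: lker (linfun (eval_at x)))%VS).
have := memv_pick (T :&: lker (linfun (eval_at x)))%VS.
rewrite memv_cap memv_ker lfunE /= => /andP[-> /eqP fx]; split => //.
Qed.

(** The characteristic polynomial of [- A] is monic of degree [r], so one of the more than [r]
    scalars at hand is not a root of it. *)
Lemma shift_unitmx r (A : 'M[K]_r) :
  card_gt K r -> exists t, t%:M + A \in unitmx.
Proof.
case=> s /andP[us ls].
have [t ts nt] : exists2 t, t \in s & ~~ root (char_poly (- A)) t.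
  apply/hasP; apply: contraT => /hasPn ht.
  have := max_poly_roots (monic_neq0 (char_poly_monic (- A))) _ us.
  rewrite size_char_poly ltnS leqNgt ls /= => -> //.
  by apply/allP=> t /ht; rewrite negbK.
exists t; rewrite unitmxE unitfE; apply: contraNN nt => /eqP dt.
rewrite /root /char_poly -horner_evalE -det_map_mx.
apply/eqP; rewrite -[RHS]dt; congr (\det _).
apply/matrixP=> i j; rewrite !mxE /= horner_evalE !(hornerE, hornerMn).
by rewrite opprK; case: eqP => _ //; rewrite ?hornerX ?horner0.
Qed.

(** Project onto [X = values T x] along [W], and lift a basis of [X] to operators [h i] of [T]. The
    projections of the vectors [h i (y + t *: x)] have matrix [t%:M + A] in that basis. When it is
    invertible, the projection maps [Y = values T (y + t *: x)] onto [X], while [W] stays in its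
    kernel on [Y + W]. *)
Lemma values_shift T x y (W : {vspace V}) :
  card_gt K (\dim (values T x)) -> (values T x :&: W = 0)%VS ->
  exists t,
    (\dim (values T x) + \dim W <= \dim (values T (y + t *: x) + W))%N.
Proof.
set X := values T x => hK XW.
pose p := daddv_pi X W; pose e := vbasis X.
have eX i : e`_i \in X by case: (ltnP i (size e)) => [l|l];
  [exact/vbasis_mem/mem_nth | rewrite nth_default ?mem0v].
have /fin_all_exists2[h hT hx] (i : 'I_(\dim X)) :
    exists2 h, h \in T & h x = e`_i.
  by have /valuesP[h hT hE] := eX i; exists h.
have pX v : v \in X -> p v = v by exact: daddv_pi_id.
have pin v : p v \in X by exact: memv_pi.
have pW v : v \in W -> p v = 0.
  move=> vW; have vXW : v \in (X + W)%VS by rewrite (subvP (addvSr _ _)).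
  have := daddv_pi_add XW vXW; rewrite (daddv_pi_id _ vW) ?(capvC W) //.
  by move=> pv; apply: (addIr v); rewrite pv add0r.
pose A := \matrix_(i, j) coord e j (p (h i y)).
have [t tA] := shift_unitmx A hK; exists t.
(* The rows of [B] give the combinations of the [h i (y + t *: x)] that project to the basis vectors
   of [X]. *)
set Y := values T _; pose B := invmx (t%:M + A).
have eY (k : 'I_(\dim X)) : e`_k = p (\sum_i B k i *: h i (y + t *: x)).
  have pE (i : 'I_(\dim X)) : p (h i (y + t *: x)) = \sum_j (t%:M + A) i j *: e`_j.
    rewrite linearD linearZ /= hx linearD linearZ /= (pX _ (eX i)).
    rewrite (coord_vbasis (pin (h i y))).
    under [RHS]eq_bigr do rewrite mxE scalerDl.
    rewrite big_split /= addrC; congr (_ + _).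
      by apply: eq_bigr => j _; rewrite mxE.
    rewrite (bigD1 i) //= mxE eqxx big1 ?addr0 // => j ji.
    by rewrite mxE eq_sym (negPf ji) scale0r.
  rewrite linear_sum /=; under eq_bigr do rewrite linearZ /= pE scaler_sumr.
  rewrite exchange_big /=.
  transitivity (\sum_j (B *m (t%:M + A)) k j *: e`_j).
    rewrite mulVmx // (bigD1 k) //= mxE eqxx scale1r big1 ?addr0 // => j jk.
    by rewrite mxE eq_sym (negPf jk) scale0r.
  apply: eq_bigr => j _; rewrite mxE scaler_suml.
  by apply: eq_bigr => i _; rewrite scalerA.
rewrite -(limg_ker_dim p (Y + W)%VS) addnC leq_add //; apply: dimvS.
  rewrite subv_cap addvSr; apply/subvP=> v /pW pv.
  by rewrite memv_ker pv.
rewrite -(span_basis (vbasisP X)); apply/span_subvP => v /(nthP 0)[i].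
rewrite size_tuple => li <-; rewrite -/e (eY (Ordinal li)).
apply: memv_img; apply: (subvP (addvSl _ _)).
by apply: memv_suml => j _; apply/memvZ/mem_values.
Qed.

(** * Membership relations at a vector whose space of values has maximal dimension *)

Section MaximalValue.
Variables (T : {vspace 'Hom(U, V)}) (x : U).
Hypothesis max_x : forall y, (\dim (values T y) <= \dim (values T x))%N.
Hypothesis hK : card_gt K (\dim (values T x)).

Lemma values_generic_line y :
  exists t, \dim (values T (y + t *: x)) = \dim (values T x).
Proof.
have [t] := values_shift y hK (capv0 _).
rewrite dimv0 addn0 addv0 => le; exists t; apply/eqP.
by rewrite eqn_leq max_x.
Qed.

(** If [w] were outside [values T x], [values_shift] with [W = <[w]>] would give a [t] for which
    [values T (y + t *: x)], which already contains [w], exceeds the maximal dimension. *)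
Lemma mem_values_line y w :
  (forall t, w \in values T (y + t *: x)) -> w \in values T x.
Proof.
move=> wT; apply: contraT => wX.
have w0 : w != 0 by apply: contraNneq wX => ->; rewrite mem0v.
have [t] := values_shift y hK (capv_line wX).
rewrite dim_vline w0 addn1 (addv_idPl _) -?memvE //.
by rewrite ltnNge max_x.
Qed.

Variable f : 'Hom(U, V).
Hypotheses (fT : f \in T) (fx : f x = 0).

Let line h t y : h (y + t *: x) = h y + t *: h x.
Proof. by rewrite linearD linearZ. Qed.

(* The operators f, h - t f and k - t h + t^2 f map y + t x to f y, h y and k y. *)
Lemma values_chain1 y : f y \in values T x.
Proof.
apply: (@mem_values_line y) => t; apply/valuesP; exists f => //.
by rewrite line fx scaler0 addr0.
Qed.

Lemma values_chain2 y h : h \in T -> h x = f y -> h y \in values T x.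
Proof.
move=> hT hx; apply: (@mem_values_line y) => t; apply/valuesP.
exists (h - t *: f); first by rewrite memvB ?memvZ.
rewrite add_lfunE opp_lfunE scale_lfunE !line fx hx.
by rewrite scaler0 addr0 addrK.
Qed.

Lemma values_chain3 y h k : h \in T -> k \in T ->
  h x = f y -> k x = h y -> k y \in values T x.
Proof.
move=> hT kT hx kx; apply: (@mem_values_line y) => t; apply/valuesP.
exists (k - t *: h + t ^+ 2 *: f); first by rewrite memvD ?memvB ?memvZ.
rewrite !add_lfunE opp_lfunE !scale_lfunE !line fx hx kx.
by rewrite scaler0 addr0 scalerDr scalerA -expr2 opprD addrA addrK subrK.
Qed.

(** Polarization of [values_chain2], from its instances at [y], [z] and [y + z]. *)
Lemma values_polar y z h k : h \in T -> k \in T ->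
  h x = f y -> k x = f z -> h z + k y \in values T x.
Proof.
move=> hT kT hx kx.
have hy := values_chain2 hT hx; have kz := values_chain2 kT kx.
have := @values_chain2 (y + z) (h + k) (memvD hT kT).
rewrite add_lfunE linearD hx kx => /(_ erefl).
rewrite add_lfunE !linearD /= => hs; have := memvB hs (memvD hy kz).
by rewrite [h y + h z + _](AC (2*2) ((1*4)*(2*3))) addrC addKr.
Qed.

Lemma values_kernel y h :
  h \in T -> h x \in limg f -> f y = 0 -> h y \in values T x.
Proof.
move=> hT /memv_imgP[z _ hx] fy.
have := values_polar (z := y) hT (mem0v T) hx; rewrite zero_lfunE fy => /(_ erefl).
by rewrite zero_lfunE addr0.
Qed.

End MaximalValue.
End Values.

(** * Extremal pairs *)

Section Extremal.
Local Open Scope ring_scope.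
Variables (K : fieldType) (U V : vectType K).
Implicit Types (f g h k m : 'Hom(U, V)) (x y z : U).

Lemma dim_lker f : (\dim (lker f) + lrank f)%N = \dim {:U}.
Proof. by rewrite -(limg_ker_dim f fullv) capfv. Qed.

Lemma card_gt_leq (m1 m2 : nat) : (m1 <= m2)%N -> card_gt K m2 -> card_gt K m1.
Proof.
by move=> le [s /andP[us ls]]; exists s; rewrite us (leq_ltn_trans le).
Qed.

(** Bundled so that the results below apply to several extensions [S] of the same [H]. *)
Record extremal (n : nat) (S H : {vspace 'Hom(U, V)}) : Prop := Extremal {
  extremal_n : (3 <= n)%N;
  extremal_card : card_gt K n;
  extremal_dim : \dim S = n.+1;
  extremal_reduced : reduced S;
  extremal_LLD : LLD S;
  extremal_hyperplane : hyperplane_of S H;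
  extremal_rank : forall f, f \in H -> f != 0 -> (2 * n - 2 <= lrank f)%N }.

Variables (n : nat) (S H : {vspace 'Hom(U, V)}).
Hypothesis SH : extremal n S H.

Definition generic x := \dim (values S x) = n.

(** Once [generic_neq0] is available, these are the nonzero non-injective operators of [S]. *)
Definition special f := [/\ f \in S, f != 0 & exists2 x, generic x & f x = 0].

Let n3 : (3 <= n)%N := extremal_n SH.

Lemma extremal_sub : (H <= S)%VS.
Proof. by case/andP: (extremal_hyperplane SH). Qed.

Lemma extremal_dimH : \dim H = n.
Proof.
by case/andP: (extremal_hyperplane SH) => _; rewrite (extremal_dim SH) => /eqP[].
Qed.

Lemma values_max y : (\dim (values S y) <= n)%N.
Proof.
have [f [fS f0 fy]] := extremal_LLD SH y.
by have := values_lt fS f0 fy; rewrite (extremal_dim SH).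
Qed.

Lemma generic_max x : generic x ->
  forall y, (\dim (values S y) <= \dim (values S x))%N.
Proof. by move=> gx y; rewrite gx values_max. Qed.

Lemma generic_card x : generic x -> card_gt K (\dim (values S x)).
Proof. by move=> ->; exact: extremal_card SH. Qed.

(** As [\dim H = n], some nonzero [f] in [H] kills [x]. Its rank is too large for its image to fit
    in [values S x], so some [f y] is outside; since [f y = f (y + t *: x)], adjoining this line to
    the values at [y + t *: x] changes nothing, and [values_shift] gives the growth. *)
Lemma values_grow x : (\dim (values S x) < n)%N ->
  exists y, (\dim (values S x) < \dim (values S y))%N.
Proof.
move=> lt; have lt' : (\dim (values H x) < \dim H)%N.
  rewrite extremal_dimH; apply: leq_ltn_trans lt.
  exact/dimvS/limgS/extremal_sub.
have [f [fH f0 fx]] := values_gt lt'; have fS := subvP extremal_sub _ fH.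
have /subvPn[_ /memv_imgP[y _ ->] fy] : ~~ (limg f <= values S x)%VS.
  apply/negP => /dimvS; have := extremal_rank SH fH f0.
  by rewrite /lrank; lia.
have fy0 : f y != 0 by apply: contraNneq fy => ->; rewrite mem0v.
have hK := card_gt_leq (ltnW lt) (extremal_card SH).
have [t] := values_shift y hK (capv_line fy).
rewrite dim_vline fy0 addn1 (addv_idPl _); first by exists (y + t *: x).
rewrite -memvE.
have -> : f y = f (y + t *: x) by rewrite linearD linearZ /= fx scaler0 addr0.
exact: mem_values.
Qed.

Lemma exists_generic : exists x, generic x.
Proof.
suff gen d x : (n <= \dim (values S x) + d)%N -> exists x, generic x.
  by apply: (gen n 0); rewrite leq_addl.
elim: d x => [|d IH] x le.
  by rewrite addn0 in le; exists x; apply/eqP; rewrite eqn_leq values_max.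
have [lt|ge] := ltnP (\dim (values S x)) n; last first.
  by exists x; apply/eqP; rewrite eqn_leq values_max.
by have [y lty] := values_grow lt; apply: (IH y); lia.
Qed.

Lemma generic_line x y : generic x -> exists t, generic (y + t *: x).
Proof.
move=> gx; have [t tE] := values_generic_line (generic_max gx) (generic_card gx) y.
by exists t; rewrite /generic tE.
Qed.

Lemma limg_sub_values x f : generic x -> f \in S -> f x = 0 ->
  (limg f <= values S x)%VS.
Proof.
move=> gx fS fx; apply/subvP => _ /memv_imgP[y _ ->].
exact: values_chain1 (generic_max gx) (generic_card gx) _ fS fx y.
Qed.

(** The image of [h] would lie in [values S x], of dimension [n < 2n - 2]. *)
Lemma generic_inj x h : generic x -> h \in H -> h x = 0 -> h = 0.
Proof.
move=> gx hH hx; apply/eqP; apply: contraT => h0.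
have := dimvS (limg_sub_values gx (subvP extremal_sub _ hH) hx).
by have := extremal_rank SH hH h0; rewrite gx /lrank; lia.
Qed.

Lemma special_notin f : special f -> f \notin H.
Proof.
case=> fS f0 [x gx fx]; apply: contra f0 => fH.
by rewrite (generic_inj gx fH fx).
Qed.

(** Evaluation at [x] is injective on [H], and [H] and [values S x] both have dimension [n]. *)
Lemma generic_lift x v : generic x -> v \in values S x ->
  exists2 h, h \in H & h x = v.
Proof.
move=> gx vX; suff /valuesP[h hH ->] : v \in values H x by exists h.
suff /eqP -> : values H x == values S x by [].
rewrite eqEdim limgS ?extremal_sub //= gx leqNgt -[n in (_ < n)%N]extremal_dimH.
apply/negP => /values_gt[h [hH h0 hx]].
by rewrite (generic_inj gx hH hx) eqxx in h0.
Qed.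

(* Suppose that im f = X. Modulo X, (f u, h x) |-> h u is an alternating bilinear
   map on X, and D h is the kernel of its partial map at h x. Counting dimensions
   forces n = 3 and dim (D h) = 2. Any two of these planes meet in some k x <> 0,
   so both are equal to D k; but h x lies in D h for every h. *)
Section SpecialRank.
Variables (x : U) (f : 'Hom(U, V)).
Hypotheses (gx : generic x) (fS : f \in S) (fx : f x = 0).
Hypothesis f_onto : limg f = values S x.

Let X := values S x.
Let D h := (f @: (h @^-1: X))%VS.

Let maxx := generic_max gx.
Let cardx := generic_card gx.
Let HS h (hH : h \in H) : h \in S := subvP extremal_sub h hH.

Let dimX : \dim X = n := gx.

Let lift_f h : h \in S -> exists z, f z = h x.
Proof.
move=> hS; have : h x \in limg f by rewrite f_onto mem_values.
by case/memv_imgP => z _ ->; exists z.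
Qed.

Let kerX h y : h \in S -> f y = 0 -> h y \in X.
Proof.
move=> hS fy; apply: (values_kernel maxx cardx fS fx) => //.
by rewrite f_onto mem_values.
Qed.

Let preimX h z : h \in S -> f z = h x -> h z \in X.
Proof. by move=> hS fz; apply: (values_chain2 maxx cardx fS fx). Qed.

Let memD h v : reflect (exists2 u, h u \in X & f u = v) (v \in D h).
Proof.
apply: (iffP memv_imgP) => -[u].
  by rewrite -memv_preim => hu ->; exists u.
by move=> hu fu; exists u; rewrite -?memv_preim.
Qed.

Let memD_lift h z : h \in S -> f z = h x -> h x \in D h.
Proof. by move=> hS fz; apply/memD; exists z => //; apply: preimX. Qed.

Let memD_sym h k z u : h \in S -> k \in S -> f z = h x -> f u = k x ->
  (h u \in X) = (k z \in X).
Proof.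
move=> hS kS fz fu.
have hk := values_polar maxx cardx fS fx hS kS (esym fz) (esym fu).
by apply/idP/idP => [/(memvB hk)|/(memvB hk)]; rewrite ?addrK // addrC addKr.
Qed.

(** Write [h (z + y) = k x = f u]. By [memD_sym], [h u] is in [X] as soon as [k z] is; and
    [values_chain3] puts [k (z + y)] in [X], [kerX] puts [k y] there. *)
Let limg_fiber h z y : h \in S -> f z = h x -> f y = 0 -> h (z + y) \in D h.
Proof.
move=> hS fz fy.
have fzy : h x = f (z + y) by rewrite linearD /= fz fy addr0.
have /valuesP[k kS kx] := values_chain2 maxx cardx fS fx hS fzy.
have [u fu] := lift_f kS.
apply/memD; exists u; last by rewrite fu.
rewrite (memD_sym hS kS fz fu).
have := values_chain3 maxx cardx fS fx hS kS fzy (esym kx).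
by rewrite linearD => /memvB/(_ (kerX kS fy)); rewrite addrK.
Qed.

(** Here dim ker h is at most dim U - (2n - 2), and dim ker f = dim U - n. The preimage of [X] under
    [h] has dimension dim ker f + dim (D h) and is mapped into [X], whence dim (D h) <= 2. The space
    [<[z]> + lker f] is mapped into [D h] by [limg_fiber], whence dim (D h) >= n - 1. *)
Let dims h : h \in H -> h != 0 -> n = 3 /\ \dim (D h) = 2.
Proof.
move=> hH h0; have hS := HS hH; have [z fz] := lift_f hS.
have fz0 : f z != 0.
  by rewrite fz; apply: contraNneq h0 => /(generic_inj gx hH) ->.
have sub_fk : (lker f <= h @^-1: X)%VS.
  by apply/subvP => y; rewrite memv_ker -memv_preim => /eqP /(kerX hS).
have dD := limg_ker_dim f (h @^-1: X)%VS.
rewrite (capv_idPr sub_fk) in dD.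
have dh := limg_ker_dim h (h @^-1: X)%VS.
have : (h @: (h @^-1: X) <= X)%VS.
  by apply/subvP => _ /memv_imgP[u uX ->]; rewrite memv_preim.
move/dimvS; rewrite dimX => dhX.
have dkh := dimvS (capvSr (h @^-1: X) (lker h)).
have dZ := limg_ker_dim h (<[z]> + lker f)%VS.
have dkZ := dimvS (capvSr (<[z]> + lker f) (lker h)).
have : (h @: (<[z]> + lker f) <= D h)%VS.
  have hz : h z \in D h.
    by have := limg_fiber hS fz (linear0 f); rewrite addr0.
  rewrite limgD subv_add limg_line -memvE hz /=.
  apply/subvP => _ /memv_imgP[y + ->]; rewrite memv_ker => /eqP fy.
  have := limg_fiber hS fz fy.
  by rewrite linearD => /memvB/(_ hz); rewrite addrC addKr.
move/dimvS => dhZ.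
have : \dim (<[z]> + lker f) = (1 + \dim (lker f))%N.
  rewrite dimv_disjoint_sum ?dim_vline.
    by have [z0|//] := eqVneq z 0; rewrite z0 linear0 eqxx in fz0.
  apply/eqP; rewrite -subv0; apply/subvP => v /memv_capP[/vlineP[c ->]].
  rewrite memv_ker memv0 linearZ scaler_eq0 (negPf fz0) orbF => /eqP ->.
  by rewrite scale0r.
move=> dZ1; have rf := dim_lker f; rewrite /lrank f_onto dimX in rf.
have dkers := dim_lker h; have rh := extremal_rank SH hH h0.
move: n3 dD dh dhX dkh dZ dkZ dhZ dZ1 rf dkers rh; rewrite -/(D h).
do !move: (\dim _); move: (lrank _) => a b c d e i j l o p.
clear; lia.
Qed.

(** If [h x] and [m x] are independent, both planes are spanned by them: [memD_sym] turns
    [m x \in D h] into [h x \in D m]. Otherwise [m] is a multiple of [h]. *)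
Let D_eq h m : h \in H -> h != 0 -> m \in H -> m != 0 -> m x \in D h -> D m = D h.
Proof.
move=> hH h0 mH m0 mD.
have [n_eq dh] := dims hH h0; have [_ dm] := dims mH m0.
have [z fz] := lift_f (HS hH); have [u fu] := lift_f (HS mH).
have hx0 : h x != 0 by apply: contraNneq h0 => /(generic_inj gx hH) ->.
have [/vlineP[c mx]|nc] := boolP (m x \in <[h x]>%VS).
  have mE : m = c *: h.
    apply/eqP; rewrite -subr_eq0; apply/eqP/(generic_inj gx).
      by rewrite memvB ?memvZ.
    by rewrite add_lfunE opp_lfunE scale_lfunE mx subrr.
  apply/eqP; rewrite eq_sym eqEdim dh dm andbT; apply: limgS.
  apply/subvP => y; rewrite -!memv_preim mE scale_lfunE.
  exact: memvZ.
have d2 : \dim (<[h x]> + <[m x]>) = 2.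
  rewrite dimv_disjoint_sum ?dim_vline ?hx0; last exact: capv_line.
  by case: eqP nc => // ->; rewrite mem0v.
have sub k : k \in H -> k != 0 -> h x \in D k -> m x \in D k ->
    D k = (<[h x]> + <[m x]>)%VS.
  move=> kH k0 hk mk; apply/eqP; rewrite eq_sym eqEdim d2 (dims kH k0).2 leqnn.
  by rewrite andbT subv_add -!memvE hk.
have hxm : h x \in D m.
  have /memD[u' hu' fu'] := mD; apply/memD; exists z => //.
  by rewrite -(memD_sym (HS hH) (HS mH) fz fu').
rewrite (sub m mH m0 hxm (memD_lift (HS mH) fu)).
by rewrite (sub h hH h0 (memD_lift (HS hH) fz) mD).
Qed.

Lemma special_not_onto : False.
Proof.
have [h hH h0] : exists2 h, h \in H & h != 0.
  exists (vpick H); first exact: memv_pick.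
  by rewrite vpick0 -dimv_eq0 extremal_dimH; lia.
have [n_eq dh] := dims hH h0.
have sub k : k \in H -> k != 0 -> (D k <= X)%VS.
  move=> kH k0; apply/subvP => v /memD[u _ <-].
  by rewrite /X -f_onto memv_img ?memvf.
have all_eq k : k \in H -> k != 0 -> D k = D h.
  move=> kH k0; have [_ dk] := dims kH k0.
  have dsum := dimv_sum_cap (D h) (D k).
  have : (D h + D k <= X)%VS by rewrite subv_add !sub.
  move/dimvS; rewrite dimX => dle.
  have : vpick (D h :&: D k)%VS != 0 by rewrite vpick0 -dimv_eq0; lia.
  have := memv_pick (D h :&: D k)%VS; set v := vpick _.
  case/memv_capP => vh vk v0.
  have [m mH mx] := generic_lift gx (subvP (sub _ hH h0) _ vh).
  have m0 : m != 0 by apply: contraNneq v0 => m0; rewrite -mx m0 zero_lfunE.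
  by rewrite -(@D_eq h m) ?mx // -(@D_eq k m) ?mx.
suff /dimvS : (X <= D h)%VS by rewrite dimX dh n_eq.
apply/subvP => v /(generic_lift gx)[k kH <-].
have [->|k0] := eqVneq k 0; first by rewrite zero_lfunE mem0v.
by have [z fz] := lift_f (HS kH); rewrite -(all_eq k) ?(memD_lift (HS kH) fz).
Qed.

End SpecialRank.

Lemma special_rank_le f : special f -> (lrank f <= n.-1)%N.
Proof.
case=> fS f0 [x gx fx]; rewrite leqNgt; apply/negP => lt.
apply: (special_not_onto gx fS fx); apply/eqP.
rewrite eqEdim limg_sub_values // gx.
by move: lt; rewrite /lrank; lia.
Qed.

Lemma hyperplane_combine f g : f \in S -> g \in S -> g \notin H ->
  exists c, f - c *: g \in H.
Proof.
move=> fS gS gH; suff : f \in (H + <[g]>)%VS.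
  case/memv_addP => h hH [_ /vlineP[c ->] ->]; exists c.
  by rewrite addrK.
suff /eqP -> : (H + <[g]>)%VS == S by [].
rewrite eqEdim subv_add extremal_sub -memvE gS /= (extremal_dim SH).
have := dimv_leqif_sup (addvSl H <[g]>).
rewrite extremal_dimH => /ltn_leqif -> ; rewrite subv_add subvv -memvE //=.
Qed.

Lemma generic_kernel x f g : generic x -> f \in S -> g \in S ->
  f x = 0 -> g x = 0 -> g != 0 -> f \in <[g]>%VS.
Proof.
move=> gx fS gS fx gx0 g0.
have gH : g \notin H by apply: special_notin; split=> //; exists x.
have [c fcg] := hyperplane_combine fS gS gH.
suff : f - c *: g = 0.
  by move/eqP; rewrite subr_eq0 => /eqP ->; rewrite memvZ ?memv_line.
apply: (generic_inj gx fcg).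
by rewrite add_lfunE opp_lfunE scale_lfunE fx gx0 scaler0 subr0.
Qed.

Lemma generic_special x : generic x -> exists2 f, special f & f x = 0.
Proof.
move=> gx; have [f [fS f0 fx]] := extremal_LLD SH x.
by exists f => //; split=> //; exists x.
Qed.

(** Some nonzero [f - c *: g] lies in [H]. Its rank is at least 2(n - 1), but its image lies in im f
    + im g, of dimension at most 2(n - 1), so every estimate is an equality. Its kernel contains ker
    f meet ker g, which bounds that intersection and makes the sum of the kernels full. *)
Lemma special_pairP f g : special f -> special g -> f \notin <[g]>%VS ->
  [/\ lrank f = n.-1, lrank g = n.-1, (limg f :&: limg g = 0)%VS &
      (lker f + lker g = fullv)%VS].
Proof.
move=> sf sg fg; have [fS _ _] := sf; have [gS _ _] := sg.
have [c kH] := hyperplane_combine fS gS (special_notin sg).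
have k0 : f - c *: g != 0.
  by apply: contra fg; rewrite subr_eq0 => /eqP ->; rewrite memvZ ?memv_line.
have kE u : (f - c *: g) u = f u - c *: g u.
  by rewrite add_lfunE opp_lfunE scale_lfunE.
set k := f - c *: g in kH k0 kE.
have rk := extremal_rank SH kH k0.
have /dimvS img_le : (limg k <= limg f + limg g)%VS.
  apply/subvP => _ /memv_imgP[u _ ->]; rewrite kE memv_add ?memv_img ?memvf //.
  by rewrite -scaleNr memvZ ?memv_img ?memvf.
have /dimvS ker_le : (lker f :&: lker g <= lker k)%VS.
  apply/subvP => u; rewrite memv_cap !memv_ker kE => /andP[/eqP -> /eqP ->].
  by rewrite scaler0 subr0.
have di := dimv_sum_cap (limg f) (limg g).
have dk := dimv_sum_cap (lker f) (lker g).
have := special_rank_le sf; have := special_rank_le sg.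
have := dim_lker f; have := dim_lker g; have := dim_lker k.
have sum_le := dimvS (subvf (lker f + lker g)).
rewrite /lrank in rk * => dk1 df dg rg rf.
have rfE : \dim (limg f) = n.-1 by clear -n3 rk img_le di rg rf; lia.
have rgE : \dim (limg g) = n.-1 by clear -n3 rk img_le di rg rf; lia.
split=> //; apply/eqP.
  by rewrite -dimv_eq0; clear -n3 rk img_le di rg rf; lia.
by rewrite eqEdim subvf /=; clear -n3 rk ker_le dk dk1 df dg rfE rgE; lia.
Qed.

(** If [f] kills a generic [x] and [f y != 0], an operator killing a generic [y + t *: x] cannot be
    proportional to [f]. *)
Lemma exists_special_pair :
  exists f g, [/\ special f, special g & f \notin <[g]>%VS].
Proof.
have [x gx] := exists_generic; have [f sf fx] := generic_special gx.
have [fS /lfunPn[y fy] _] := sf; rewrite zero_lfunE in fy.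
have [t gy] := generic_line y gx; have [g sg gy0] := generic_special gy.
exists f, g; split=> //; apply/negP => /vlineP[c fE].
case/eqP: fy; have -> : f y = f (y + t *: x).
  by rewrite linearD linearZ /= fx scaler0 addr0.
by rewrite fE scale_lfunE gy0 scaler0.
Qed.

(** * Block decomposition along two independent special operators *)

Section SpecialPair.
Variables (f g : 'Hom(U, V)).
Hypotheses (sf : special f) (sg : special g) (fg : f \notin <[g]>%VS).

Let fS : f \in S. Proof. by case: sf. Qed.
Let gS : g \in S. Proof. by case: sg. Qed.

Lemma special_pairC : g \notin <[f]>%VS.
Proof.
have [_ g0 _] := sg.
apply: contra fg => /vlineP[c gE]; apply/vlineP; exists c^-1.
rewrite gE scalerA mulVf ?scale1r //.
by apply: contraNneq g0 => c0; rewrite gE c0 scale0r.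
Qed.

Lemma special_disjoint v : v \in limg f -> v \in limg g -> v = 0.
Proof.
have [_ _ fg0 _] := special_pairP sf sg fg => vf vg.
by apply/eqP; rewrite -memv0 -fg0 memv_cap vf.
Qed.

Lemma special_limg_ker : (g @: lker f)%VS = limg g.
Proof.
have [_ _ _ fgU] := special_pairP sf sg fg.
rewrite -fgU limgD (_ : g @: lker g = 0)%VS ?addv0 //.
by apply/eqP; rewrite -lkerE.
Qed.

Lemma values_special x : generic x -> f x = 0 ->
  values S x = (limg f + <[g x]>)%VS.
Proof.
move=> gx fx; have [rf _ fg0 _] := special_pairP sf sg fg.
have gx0 : g x != 0.
  by apply: contra fg => /eqP g0; apply: (generic_kernel gx) => //; case: sg.
apply/eqP; rewrite eq_sym eqEdim subv_add limg_sub_values // -memvE.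
rewrite mem_values //= gx dimv_disjoint_sum ?dim_vline ?gx0; last first.
  apply/eqP; rewrite -subv0 -fg0 capvS // -memvE.
  by rewrite memv_img ?memvf.
by move: rf; rewrite /lrank => ->; clear -n3; lia.
Qed.

(* Near a generic x in ker f, the defect of h - c g lies in im f + K (g x); moving x
   inside ker f cuts this down to im f. *)
Lemma special_block h : h \in S ->
  exists c, forall y, f y = 0 -> h y - c *: g y \in limg f.
Proof.
move=> hS; have [_ f0 [x gx fx]] := sf.
have : h x \in (limg f + <[g x]>)%VS by rewrite -values_special ?mem_values.
case/memv_addP => p pf [_ /vlineP[c ->] hx]; exists c.
pose h' := h - c *: g.
have h'S : h' \in S by rewrite memvB ?memvZ.
have h'E y : h' y = h y - c *: g y.
  by rewrite add_lfunE opp_lfunE scale_lfunE.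
have h'x : h' x \in limg f by rewrite h'E hx addrK.
have kill x' : generic x' -> f x' = 0 -> h' x' \in limg f ->
    forall y, f y = 0 -> h' y \in (limg f + <[g x']>)%VS.
  move=> gx' fx' hx' y fy; rewrite -values_special //.
  exact: values_kernel (generic_max gx') (generic_card gx') _ fS fx' _ _ h'S hx' fy.
(* The image of [lker f] under [g] has dimension [n - 1 >= 2], so it is not contained in a line. *)
have /subvPn[_ /memv_imgP[z zf ->] gz] : ~~ (g @: lker f <= <[g x]>)%VS.
  have [_ rg _ _] := special_pairP sf sg fg.
  rewrite special_limg_ker; apply/negP => /dimvS; rewrite dim_vline.
  by move: rg; rewrite /lrank; clear -n3; case: eqP => _ /=; lia.
have [t gx'] := generic_line z gx; set x' := z + t *: x in gx'.
have fx' : f x' = 0.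
  by move: zf; rewrite memv_ker linearD linearZ /= fx scaler0 addr0 => /eqP.
have gx'N : g x' \notin <[g x]>%VS.
  apply: contra gz => gx'x; rewrite -[g z](addrK (t *: g x)).
  by rewrite memvB ?memvZ ?memv_line //; move: gx'x; rewrite linearD linearZ.
(* As im f and im g meet trivially and [g x], [g x'] are independent, the two spaces share only im
   f. *)
have both v : v \in (limg f + <[g x]>)%VS -> v \in (limg f + <[g x']>)%VS ->
    v \in limg f.
  case/memv_addP => p1 p1f [_ /vlineP[a ->] ->].
  case/memv_addP => p2 p2f [_ /vlineP[b ->]] E.
  have E' : p1 - p2 = b *: g x' - a *: g x.
    by apply/eqP; rewrite subr_eq addrAC eq_sym subr_eq E addrC.
  have d0 : p1 - p2 = 0.
    apply: special_disjoint; first exact: memvB.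
    by rewrite E' memvB ?memvZ ?memv_img ?memvf.
  move: E' p1f; rewrite d0 => /esym/eqP; rewrite subr_eq0 => /eqP bE p1f.
  have [b0|b0] := eqVneq b 0; first by rewrite -bE b0 scale0r addr0.
  case/negP: gx'N; apply/vlineP; exists (b^-1 * a).
  by rewrite -scalerA -bE scalerA mulVf ?scale1r.
have h'x' : h' x' \in limg f.
  apply: both; first exact: kill gx fx h'x x' fx'.
  by rewrite -values_special ?mem_values.
by move=> y fy; rewrite -h'E; apply: both; apply: kill.
Qed.

End SpecialPair.

Section SpecialPairDim.
Variables (f g : 'Hom(U, V)).
Hypotheses (sf : special f) (sg : special g) (fg : f \notin <[g]>%VS).

Lemma special_decomp u : exists u1 u2, [/\ f u1 = 0, g u2 = 0 & u = u1 + u2].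
Proof.
have [_ _ _ fgU] := special_pairP sf sg fg.
have := memvf u; rewrite -fgU => /memv_addP[u1 fu1 [u2 gu2 ->]].
by exists u1, u2; split=> //; apply/eqP; rewrite -memv_ker.
Qed.

(** By [special_block], every operator of [S] maps ker f and ker g, hence U, into im f + im g;
    reducedness says that these values span V. *)
Lemma special_sum_full : (limg f + limg g = fullv)%VS.
Proof.
apply/eqP; rewrite eqEsubv subvf /=; apply/subvP => v _.
have [s [sS ->]] := (extremal_reduced SH).2 v.
rewrite big_seq; apply: memv_suml => -[h u] /sS /= hS.
have [u1 [u2 [fu1 gu2 ->]]] := special_decomp u.
have [c hc] := special_block sf sg fg hS.
have [d hd] := special_block sg sf (special_pairC sg fg) hS.
rewrite linearD /= -[h u1](subrK (c *: g u1)) -[h u2](subrK (d *: f u2)).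
have fI u0 : f u0 \in limg f by rewrite memv_img ?memvf.
have gI u0 : g u0 \in limg g by rewrite memv_img ?memvf.
apply: memvD; first by rewrite memv_add ?memvZ ?hc.
by rewrite addrC memv_add ?memvZ ?hd.
Qed.

(** The two forms of [special_block] put [h u] in both im f and im g, so every [h] in [S] kills
    [u]. *)
Lemma special_cap_ker u : f u = 0 -> g u = 0 -> u = 0.
Proof.
move=> fu gu; apply: (extremal_reduced SH).1 => h hS.
have [c hc] := special_block sf sg fg hS.
have [d hd] := special_block sg sf (special_pairC sg fg) hS.
apply: (special_disjoint sf sg fg).
  by have := hc _ fu; rewrite gu scaler0 subr0.
by have := hd _ gu; rewrite fu scaler0 subr0.
Qed.

Lemma special_dim_ker :
  [/\ \dim (lker f) = n.-1, \dim (lker g) = n.-1, \dim {:U} = (2 * n - 2)%N &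
      \dim {:V} = (2 * n - 2)%N].
Proof.
have [rf rg fg0 fgU] := special_pairP sf sg fg.
have cap0 : (lker f :&: lker g)%VS = 0%VS.
  apply/eqP; rewrite -subv0; apply/subvP => u; rewrite memv_cap !memv_ker memv0.
  by case/andP => /eqP fu /eqP gu; rewrite (special_cap_ker fu gu).
have := dimv_sum_cap (lker f) (lker g); rewrite fgU cap0 dimv0.
have := dimv_sum_cap (limg f) (limg g); rewrite special_sum_full fg0 dimv0.
have := dim_lker f; have := dim_lker g.
by move: rf rg; rewrite /lrank => -> ->; clear -n3; split; lia.
Qed.

End SpecialPairDim.

Lemma extremal_dimU : \dim {:U} = (2 * n - 2)%N.
Proof.
by have [f [g [sf sg fg]]] := exists_special_pair; case: (special_dim_ker sf sg fg).
Qed.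

Lemma extremal_dimV : \dim {:V} = (2 * n - 2)%N.
Proof.
by have [f [g [sf sg fg]]] := exists_special_pair; case: (special_dim_ker sf sg fg).
Qed.

Lemma extremal_ker0 h : h \in H -> h != 0 -> lker h = 0%VS.
Proof.
move=> hH h0; apply/eqP; rewrite -dimv_eq0.
have := extremal_rank SH hH h0; have := dim_lker h.
by rewrite extremal_dimU; lia.
Qed.

Lemma extremal_inj h u : h \in H -> h != 0 -> h u = 0 -> u = 0.
Proof.
move=> hH h0 hu; apply/eqP; rewrite -memv0 -(extremal_ker0 hH h0) memv_ker hu.
by rewrite eqxx.
Qed.

Lemma values_hyperplane x : x != 0 -> \dim (values H x) = n.
Proof.
move=> x0; apply/eqP; rewrite eqn_leq -[n in X in X && _]extremal_dimH values_le.
rewrite leqNgt -[n in (_ < n)%N]extremal_dimH /=.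
apply/negP => /values_gt[h [hH h0 hx]].
by rewrite (extremal_inj hH h0 hx) eqxx in x0.
Qed.

Lemma generic_neq0 x : x != 0 -> generic x.
Proof.
move=> x0; apply/eqP; rewrite eqn_leq values_max /= -(values_hyperplane x0).
exact/dimvS/limgS/extremal_sub.
Qed.

(** This is what places [S] inside the reflexive closure of [H]. For [x != 0] the right side already
    has the maximal dimension [n], as nonzero operators of [H] are injective. *)
Lemma values_hyperplaneE x : values S x = values H x.
Proof.
have [->|x0] := eqVneq x 0.
  apply/eqP; rewrite eqEsubv (limgS _ extremal_sub) andbT.
  by apply/subvP => v /valuesP[h _ ->]; rewrite linear0 mem0v.
apply/eqP; rewrite eq_sym eqEdim (limgS _ extremal_sub) values_hyperplane //.
exact: values_max.
Qed.

Lemma special_killing x f : x != 0 -> f \in S -> f != 0 -> f x = 0 -> special f.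
Proof. by move=> x0 fS f0 fx; split=> //; exists x => //; apply: generic_neq0. Qed.

End Extremal.

(** * The twisted form of S *)

Section LinearMaps.
Local Open Scope ring_scope.
Variable K : fieldType.

Lemma lfun_bijective (L M : vectType K) (f : 'Hom(L, M)) :
  (forall u, f u = 0 -> u = 0) -> \dim {:L} = \dim {:M} -> bijective f.
Proof.
move=> f0 dLM; have kf : lker f == 0%VS.
  rewrite -subv0; apply/subvP => u; rewrite memv_ker memv0.
  by move=> /eqP/f0 ->.
have imf : limg f = fullv.
  apply/eqP; rewrite eqEdim subvf /= -dLM limg_dim_eq //.
  by rewrite (eqP kf) capv0.
exists (f^-1)%VF; first exact: lker0_lfunK.
by move=> v; rewrite limg_lfunVK // imf memvf.
Qed.

Lemma bijective_inv_lfun (L M : vectType K) (f : 'Hom(L, M)) :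
  bijective f -> cancel f (f^-1)%VF /\ cancel (f^-1)%VF f.
Proof.
move=> bf; have kf : lker f == 0%VS by apply/lker0P/bij_inj.
split; first exact: lker0_lfunK.
move=> v; rewrite limg_lfunVK //.
by case: bf => g _ gK; rewrite -[v]gK memv_img ?memvf.
Qed.

Section RowCombination.
Variables (L : vectType K) (m : nat) (e : m.-tuple L).
Definition row_combination (v : 'rV[K]_m) := \sum_i v 0 i *: e`_i.
Fact row_combination_linear : linear row_combination.
Proof.
move=> c u v; rewrite /row_combination scaler_sumr -big_split /=.
by apply: eq_bigr => i _; rewrite !mxE scalerDl scalerA.
Qed.
HB.instance Definition _ := GRing.isLinear.Build K 'rV[K]_m L *:%R
  row_combination row_combination_linear.
End RowCombination.

Lemma vspace_param (L : vectType K) (W : {vspace L}) m : \dim W = m ->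
  exists j : 'Hom('rV[K]_m, L), (forall u, j u = 0 -> u = 0) /\ limg j = W.
Proof.
move=> <-; pose e := vbasis W; exists (linfun (row_combination e)); split=> [u|].
  rewrite lfunE /= => u0; apply/rowP => i; rewrite mxE.
  by have /freeP/(_ (fun i => u 0 i))-> := basis_free (vbasisP W).
apply/eqP; rewrite eqEsubv; apply/andP; split; apply/subvP => v.
  case/memv_imgP => u _ ->; rewrite lfunE /=.
  apply: memv_suml => i _; apply/memvZ/vbasis_mem/mem_nth.
  by rewrite size_tuple.
move=> vW; have -> : v = linfun (row_combination e) (\row_i coord e i v).
  rewrite lfunE /= {1}(coord_vbasis vW).
  by apply: eq_bigr => i _; rewrite mxE.
by rewrite memv_img ?memvf.
Qed.

Lemma collinearZ (L : vectType K) (c : K) (v : L) : collinear (c *: v) v.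
Proof. by rewrite /collinear free_cons span_seq1 memvZ ?memv_line. Qed.

Section HomProduct.
Variables (A L M : vectType K) (j : 'Hom(A, 'Hom(L, M))).
Variables (r : 'Hom(M, A)) (s : 'Hom(A, L)).

(** Common shape of the two products of the algebra to be built: [j] parametrizes the off-diagonal
    operators, [s] embeds [A] as a kernel, [r] reads an image in [A]. *)
Definition hom_product (x y : A) : A := r (j x (s y)).

Fact hom_product_bilinear :
  bilinear_for (GRing.Scale.Law.clone _ _ *:%R _)
    (GRing.Scale.Law.clone _ _ *:%R _) hom_product.
Proof.
split=> u c x y; rewrite /hom_product.
  by rewrite linearP add_lfunE scale_lfunE linearP.
by rewrite !linearP.
Qed.
HB.instance Definition _ :=
  bilinear_isBilinear.Build K A A A *:%R *:%R hom_product hom_product_bilinear.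
End HomProduct.

Section PairMap.
Variables (A L : vectType K) (p q : 'Hom(A, L)).
Definition pair_fun (w : A * A) : L := p w.1 + q w.2.
Fact pair_fun_linear : linear pair_fun.
Proof.
by move=> c [a b] [a' b']; rewrite /pair_fun /= !linearP scalerDr addrACA.
Qed.
HB.instance Definition _ :=
  GRing.isLinear.Build K (A * A)%type L *:%R pair_fun pair_fun_linear.
End PairMap.

End LinearMaps.

(** * Off-diagonal operators and the LDB division algebra that they define *)

Section TwistedForm.
Local Open Scope ring_scope.
Variables (K : fieldType) (U V : vectType K) (n : nat).
Variables (S H : {vspace 'Hom(U, V)}).
Hypothesis SH : extremal n S H.
Variables (f g : 'Hom(U, V)).
Hypotheses (sf : special n S f) (sg : special n S g) (fg : f \notin <[g]>%VS).

Let gf := special_pairC sg fg.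
Let fS : f \in S. Proof. by case: sf. Qed.
Let gS : g \in S. Proof. by case: sg. Qed.

(* By special_block, it is enough to test one nonzero vector of each kernel. *)
Definition off_diagonal : {vspace 'Hom(U, V)} :=
  (S :&: linfun (eval_at (vpick (lker f))) @^-1: limg f
     :&: linfun (eval_at (vpick (lker g))) @^-1: limg g)%VS.

Let D := off_diagonal.

(** The scalar [c] of [special_block] vanishes: [c *: g' x] lies in both images, and [g' x != 0]
    because [x] is a nonzero vector of ker f'. *)
Let block_zero (f' g' : 'Hom(U, V)) (h : 'Hom(U, V)) :
  special n S f' -> special n S g' -> f' \notin <[g']>%VS -> h \in S ->
  h (vpick (lker f')) \in limg f' ->
  forall y, f' y = 0 -> h y \in limg f'.
Proof.
move=> sf' sg' fg' hS; set x := vpick _ => hx y fy.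
have fx : f' x = 0 by apply/eqP; rewrite -memv_ker memv_pick.
have [c hc] := special_block SH sf' sg' fg' hS.
have c0 : c *: g' x = 0.
  apply: (special_disjoint SH sf' sg' fg'); last by rewrite memvZ ?memv_img ?memvf.
  by rewrite -[_ *: _](subKr (h x)) memvB ?hc.
have x0 : x != 0.
  have [dk _ _ _] := special_dim_ker SH sf' sg' fg'.
  by rewrite vpick0 -dimv_eq0 dk; have := extremal_n SH; lia.
have gx0 : g' x != 0.
  by apply: contraNneq x0 => /(special_cap_ker SH sf' sg' fg' fx) ->.
have := hc _ fy; move/eqP: c0; rewrite scaler_eq0 (negPf gx0) orbF => /eqP ->.
by rewrite scale0r subr0.
Qed.

Lemma off_diagonalP h : h \in D <->
  [/\ h \in S, forall y, f y = 0 -> h y \in limg f &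
      forall y, g y = 0 -> h y \in limg g].
Proof.
have killf : f (vpick (lker f)) = 0 by apply/eqP; rewrite -memv_ker memv_pick.
have killg : g (vpick (lker g)) = 0 by apply/eqP; rewrite -memv_ker memv_pick.
rewrite /D /off_diagonal !memv_cap -!memv_preim !lfunE /= /eval_at.
split=> [/andP[/andP[hS hf] hg]|[hS hf hg]]; last by rewrite hS hf ?hg.
by split=> //; [apply: (block_zero sf sg) | apply: (block_zero sg sf)].
Qed.

Lemma off_diagonal_sub : (D <= S)%VS.
Proof. by apply/subvP => h /off_diagonalP[]. Qed.

Lemma off_diagonal_decomp h : h \in S ->
  exists s c d, s \in D /\ h = s + c *: f + d *: g.
Proof.
move=> hS; have [d hd] := special_block SH sf sg fg hS.
have [c hc] := special_block SH sg sf gf hS.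
exists (h - c *: f - d *: g), c, d; split; last first.
  by rewrite addrAC subrK subrK.
apply/off_diagonalP; split; first by rewrite !memvB ?memvZ.
  move=> y fy; rewrite !add_lfunE !opp_lfunE !scale_lfunE fy scaler0 subr0.
  exact: hd.
move=> y gy; rewrite !add_lfunE !opp_lfunE !scale_lfunE gy scaler0 subr0.
exact: hc.
Qed.

(** On ker f the relation reads [s u + d *: g u = 0], with terms in im f and im g, so [d *: g]
    vanishes there; ker g gives [c] in the same way. *)
Lemma off_diagonal_indep s c d :
  s \in D -> s + c *: f + d *: g = 0 -> [/\ s = 0, c = 0 & d = 0].
Proof.
move=> /off_diagonalP[sS sDf sDg] E.
have Eu u : s u + c *: f u + d *: g u = 0.
  by have := congr1 (fun h : 'Hom(U, V) => h u) E;
     rewrite !add_lfunE !scale_lfunE zero_lfunE.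
have neq0 (f' : 'Hom(U, V)) : special n S f' -> f' != 0 by case.
have d0 : d = 0.
  apply/eqP; apply: contraT => d0.
  have /lfunPn[u] := neq0 _ sg; rewrite zero_lfunE => /eqP; case.
  have [u1 [u2 [fu1 gu2 ->]]] := special_decomp SH sf sg fg u.
  rewrite linearD /= gu2 addr0; apply: (special_disjoint SH sf sg fg).
    have := Eu u1; rewrite fu1 scaler0 addr0 => /eqP.
    rewrite addrC addr_eq0 => /eqP dg.
    rewrite -[g u1]scale1r -(mulVf d0) -scalerA dg memvZ // memvN.
    exact: sDf.
  by rewrite memv_img ?memvf.
have c0 : c = 0.
  apply/eqP; apply: contraT => c0.
  have /lfunPn[u] := neq0 _ sf; rewrite zero_lfunE => /eqP; case.
  have [u1 [u2 [fu1 gu2 ->]]] := special_decomp SH sf sg fg u.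
  rewrite linearD /= fu1 add0r; apply: (special_disjoint SH sf sg fg).
    by rewrite memv_img ?memvf.
  have := Eu u2; rewrite gu2 scaler0 addr0 => /eqP.
  rewrite addrC addr_eq0 => /eqP dg.
  rewrite -[f u2]scale1r -(mulVf c0) -scalerA dg memvZ // memvN.
  exact: sDg.
by move: E; rewrite d0 c0 !scale0r !addr0.
Qed.

(** Some [s - c *: f] lies in [H], is nonzero by independence, hence injective, and agrees with [s]
    on ker f. *)
Lemma off_diagonal_injl s y : s \in D -> s != 0 -> f y = 0 -> s y = 0 -> y = 0.
Proof.
move=> sD s0 fy sy; have sS := subvP off_diagonal_sub _ sD.
have [c sc] := hyperplane_combine SH sS fS (special_notin SH sf).
apply: (extremal_inj SH sc).
  apply: contra s0 => /eqP E.
  have [] // := @off_diagonal_indep s (- c) 0 sD; last by move=> ->.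
  by rewrite scale0r addr0 scaleNr.
by rewrite add_lfunE opp_lfunE scale_lfunE fy sy scaler0 subr0.
Qed.

Lemma off_diagonal_injr s y : s \in D -> s != 0 -> g y = 0 -> s y = 0 -> y = 0.
Proof.
move=> sD s0 fy sy; have sS := subvP off_diagonal_sub _ sD.
have [c sc] := hyperplane_combine SH sS gS (special_notin SH sg).
apply: (extremal_inj SH sc).
  apply: contra s0 => /eqP E.
  have [] // := @off_diagonal_indep s 0 (- c) sD; last by move=> ->.
  by rewrite scale0r addr0 scaleNr.
by rewrite add_lfunE opp_lfunE scale_lfunE fy sy scaler0 subr0.
Qed.

Lemma dim_off_diagonal : \dim D = n.-1.
Proof.
have /negPf f0 : f != 0 by case: sf.
have /negPf g0 : g != 0 by case: sg.
have d2 : \dim (<[f]> + <[g]>) = 2.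
  rewrite dimv_disjoint_sum ?dim_vline ?f0 ?g0 //.
  apply/eqP; rewrite -subv0.
  apply/subvP => h /memv_capP[/vlineP[a ->] /vlineP[b E]].
  have E' : 0 + a *: f + (- b) *: g = 0 by rewrite add0r E scaleNr subrr.
  by have [_ -> _] := off_diagonal_indep (mem0v D) E'; rewrite scale0r mem0v.
have cap0 : (D :&: (<[f]> + <[g]>) = 0)%VS.
  apply/eqP; rewrite -subv0.
  apply/subvP => h /memv_capP[hD /memv_addP[_ /vlineP[a ->] [_ /vlineP[b ->] E]]].
  have E' : h + (- a) *: f + (- b) *: g = 0.
    by rewrite E !scaleNr -addrA -opprD subrr.
  by have [-> _ _] := off_diagonal_indep hD E'; rewrite mem0v.
have full : (D + (<[f]> + <[g]>) = S)%VS.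
  apply/eqP; rewrite eqEsubv !subv_add -!memvE fS gS off_diagonal_sub /=.
  apply/subvP => h /off_diagonal_decomp[s [c [d [sD ->]]]].
  by rewrite -addrA memv_add // memv_add // memvZ ?memv_line.
have := dimv_sum_cap D (<[f]> + <[g]>); rewrite full cap0 d2 dimv0.
by rewrite (extremal_dim SH); lia.
Qed.

(** The row space [A] parametrizes the off-diagonal operators, im f and im g through [j], [p] and
    [q]. Identifying V with A^2 by [(p, q)], and U with V by [f + g], turns [j x + l *: f + m *: g]
    into [twisted_op x l m]. *)
Lemma extremal_twisted :
  exists A : LDBAlgebra K,
    \dim {:ldb_sort A} = n.-1 /\ equivalent S (twisted_space A).
Proof.
pose A : vectType K := 'rV[K]_(n.-1).
have n3 := extremal_n SH.
have [rf rg fg0 fgU] := special_pairP SH sf sg fg.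
have [j [j0 jD]] := vspace_param dim_off_diagonal.
have [p [p0 pf]] := vspace_param rf.
have [q [q0 qg]] := vspace_param rg.
have dA : \dim {:A} = n.-1 by rewrite dimvf dim_matrix; apply: mul1n.
have jin x : j x \in D by rewrite -jD memv_img ?memvf.
have pin x : p x \in limg f by rewrite -pf memv_img ?memvf.
have qin x : q x \in limg g by rewrite -qg memv_img ?memvf.
have fin u : f u \in limg f by rewrite memv_img ?memvf.
have gin u : g u \in limg g by rewrite memv_img ?memvf.
have dis a b : a \in limg f -> b \in limg g -> a + b = 0 -> a = 0 /\ b = 0.
  move=> af bg /eqP; rewrite addr_eq0 => /eqP ab.
  have b0 : b = 0.
    by apply: (special_disjoint SH sf sg fg) bg; rewrite -memvN -ab.
  by rewrite ab b0 oppr0.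
have j_neq0 x : x != 0 -> j x != 0 by apply: contraNneq => /j0 ->.
(* k identifies U with V and turns f and g into the projections of V = im f + im g. *)
pose k := f + g.
have kb : bijective k.
  apply: lfun_bijective; last by rewrite (extremal_dimU SH) (extremal_dimV SH).
  move=> u; rewrite add_lfunE => /(dis _ _ (fin u) (gin u))[].
  exact: (special_cap_ker SH sf sg fg).
have [kK Kk] := bijective_inv_lfun kb.
pose i := (k^-1)%VF; rewrite -/i in kK Kk.
have iq b : f (i (q b)) = 0 /\ g (i (q b)) = q b.
  have := Kk (q b); rewrite /k add_lfunE => /eqP; rewrite -subr_eq0 -addrA => /eqP.
  by case/dis => //; [rewrite memvB | move=> -> /eqP; rewrite subr_eq0 => /eqP].
have ip a : f (i (p a)) = p a /\ g (i (p a)) = 0.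
  have := Kk (p a); rewrite /k add_lfunE => /eqP; rewrite -subr_eq0 addrAC => /eqP.
  by case/dis => //; [rewrite memvB | move=> /eqP; rewrite subr_eq0 => /eqP].
(* [star] is the block from ker f to im f, [bullet] the block from ker g to im g. *)
pose star : A -> A -> A := hom_product j (p^-1)%VF (i \o q)%VF.
pose bullet : A -> A -> A := hom_product j (q^-1)%VF (i \o p)%VF.
have starE x b : p (star x b) = j x (i (q b)).
  rewrite /star /hom_product comp_lfunE limg_lfunVK // pf.
  by have /off_diagonalP[_ + _] := jin x; apply; case: (iq b).
have bulletE x a : q (bullet x a) = j x (i (p a)).
  rewrite /bullet /hom_product comp_lfunE limg_lfunVK // qg.
  by have /off_diagonalP[_ _] := jin x; apply; case: (ip a).
have star_reg : regular star.
  move=> a b a0; apply: contra => /eqP sab.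
  have [fb gb] := iq b; have := starE a b; rewrite sab linear0 => /esym.
  move/(off_diagonal_injl (jin a) (j_neq0 _ a0) fb) => i0.
  by move: gb; rewrite i0 linear0 => /esym/q0 ->.
have bullet_reg : regular bullet.
  move=> a b a0; apply: contra => /eqP sab.
  have [fb gb] := ip b; have := bulletE a b; rewrite sab linear0 => /esym.
  move/(off_diagonal_injr (jin a) (j_neq0 _ a0) gb) => i0.
  by move: fb; rewrite i0 linear0 => /esym/p0 ->.
have qli : quasi_left_inversion star bullet.
  split=> x y.
    split=> [xy0|[->|->]].
    - have [->|x0] := eqVneq x 0; first by left.
      have [->|y0] := eqVneq y 0; first by right.
      by have := bullet_reg _ _ x0 y0; rewrite xy0 eqxx.
    - by rewrite /bullet linear0l.
    - by rewrite /bullet linear0r.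
  have [x0|x0] := eqVneq x 0.
    by rewrite x0 /star linear0l -(scale0r y) collinearZ.
  have [y0|y0] := eqVneq y 0.
    by rewrite y0 /bullet /star !linear0r -[X in collinear X](scale0r 0) collinearZ.
  suff [c cE] : exists c, star x (bullet x y) = c *: y by rewrite cE collinearZ.
  (* Local linear dependence at [u + v], with [u] in ker g and [v] in ker f, yields an operator
     [s + l *: f + m *: g] killing it. Its im g component forces [s = - m *: j x]; its im f
     component is then the required collinearity. *)
  pose u := i (p y); pose v := i (q (bullet x y)).
  have [fu gu] := ip y; have [fv gv] := iq (bullet x y).
  rewrite -/u -/v in fu gu fv gv.
  have u0 : u != 0.
    apply: contraNneq y0 => u0; apply/eqP/p0.
    by rewrite -fu u0 linear0.
  have [t [tS t0 tuv]] := extremal_LLD SH (u + v).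
  have [s [l [m [sD tE]]]] := off_diagonal_decomp tS.
  have [sS sDf sDg] := (off_diagonalP s).1 sD.
  have [E1 E2] : s v + l *: f u = 0 /\ s u + m *: g v = 0.
    apply: dis; rewrite ?memvD ?memvZ ?sDf ?sDg //.
    rewrite -tuv tE !add_lfunE !scale_lfunE !linearD /= fv gu !(scaler0, addr0, add0r).
    by rewrite addrACA [s v + s u]addrC addrA.
  (* Since [j x u = g v], the off-diagonal operator [s + m *: j x] kills the nonzero vector [u] of
     ker g. *)
  have sE : s = - m *: j x.
    apply/eqP; rewrite -subr_eq0 scaleNr opprK; apply: contraT => sj0.
    case/negP: u0; apply/eqP; apply: (off_diagonal_injr _ sj0 gu).
      by rewrite memvD ?memvZ.
    by rewrite add_lfunE scale_lfunE -bulletE -gv.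
  have m0 : m != 0.
    apply: contraNneq t0 => m0; move: sE; rewrite m0 oppr0 scale0r => s0.
    move: E1; rewrite s0 zero_lfunE add0r => /eqP; rewrite scaler_eq0.
    have /negPf -> : f u != 0 by rewrite fu; apply: contraNneq y0 => /p0 ->.
    by rewrite orbF tE s0 m0 => /eqP ->; rewrite !scale0r !addr0.
  exists (m^-1 * l); apply/eqP; rewrite -subr_eq0; apply/eqP/p0.
  rewrite linearB linearZ /= starE -/v -fu.
  move: E1; rewrite sE scale_lfunE scaleNr => /eqP; rewrite addrC subr_eq0 => /eqP E1.
  by rewrite -scalerA E1 scalerA mulVf // scale1r subrr.
have dA0 : (0 < \dim {:A})%N by rewrite dA; lia.
pose LA := @LDBAlgebra_Build K A (hom_product j (p^-1)%VF (i \o q)%VF)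
  (hom_product j (q^-1)%VF (i \o p)%VF) dA0 star_reg qli.
exists LA; split; first exact: dA.
pose G : 'Hom((LA * LA)%type, V) := linfun (pair_fun p q).
have GE a b : G (a, b) = p a + q b by rewrite lfunE.
have Gb : bijective G.
  apply: lfun_bijective.
    by case=> a b; rewrite GE => /dis[] // /p0 -> /q0 ->.
  rewrite (extremal_dimV SH) dimvf; move: dA; rewrite dimvf => dA.
  suff -> : dim (LA * LA)%type = (dim A + dim A)%N by rewrite dA; clear -n3; lia.
  by [].
have [GK KG] := bijective_inv_lfun Gb.
have Fb : bijective (G^-1 \o k)%VF.
  apply: eq_bij (_ : bijective (G^-1%VF \o k)) _ _.
    by apply: bij_comp kb; exists G.
  by move=> u; rewrite comp_lfunE.
exists (G^-1 \o k)%VF, G; split=> //.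
have key x l m : (G \o twisted_op x l m \o (G^-1 \o k))%VF = j x + l *: f + m *: g.
  apply/lfunP => u; rewrite !comp_lfunE.
  case E : (G^-1%VF (k u)) => [a b].
  have kE : k u = p a + q b by rewrite -GE -E KG.
  have [fu gu] : f u = p a /\ g u = q b.
    have : (f u - p a) + (g u - q b) = 0.
      by rewrite addrACA -opprD -kE /k add_lfunE subrr.
    case/dis; rewrite ?memvB // => /eqP + /eqP.
    by rewrite !subr_eq0 => /eqP -> /eqP ->.
  rewrite twisted_opE GE !add_lfunE !scale_lfunE !linearD !linearZ /= starE bulletE fu gu.
  have -> : u = i (p a) + i (q b) by rewrite -[LHS]kK kE linearD.
  by rewrite linearD /= addrACA addrA [j x _ + j x _]addrC.
move=> h; split=> [hS|[_ /twisted_spaceP[x [l [m ->]]] ->]].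
  have [s [l [m [sD ->]]]] := off_diagonal_decomp hS.
  move: sD; rewrite -jD => /memv_imgP[x _ ->].
  exists (@twisted_op _ LA x l m); first by apply/twisted_spaceP; exists x, l, m.
  by rewrite key.
rewrite key !memvD ?memvZ //; exact: (subvP off_diagonal_sub _ (jin x)).
Qed.

End TwistedForm.

(** * Twisted operator spaces *)

Lemma linear_lfun (K : fieldType) (L M : vectType K) (f : L -> M) :
  linear f -> exists F : 'Hom(L, M), F =1 f.
Proof.
move=> lf; pose lM := GRing.isLinear.Build K L M *:%R f lf.
pose f' : {linear L -> M} := HB.pack f lM.
by exists (linfun f') => x; rewrite lfunE.
Qed.

Section Conjugation.
Local Open Scope ring_scope.
Variables (K : fieldType) (U V U' V' : vectType K).
Variables (F : 'Hom(U, U')) (G : 'Hom(V', V)).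

Definition conj_fun (g : 'Hom(U', V')) : 'Hom(U, V) := (G \o g \o F)%VF.
Fact conj_fun_linear : linear conj_fun.
Proof.
move=> c f g; apply/lfunP => u.
by rewrite /conj_fun !(comp_lfunE, add_lfunE, scale_lfunE) linearP.
Qed.
HB.instance Definition _ :=
  GRing.isLinear.Build K 'Hom(U', V') 'Hom(U, V) *:%R conj_fun conj_fun_linear.

Definition conj_lfun : 'Hom('Hom(U', V'), 'Hom(U, V)) := linfun conj_fun.

Lemma conj_lfunE (g : 'Hom(U', V')) (u : U) : conj_lfun g u = G (g (F u)).
Proof. by rewrite /conj_lfun (lfunE conj_fun) /conj_fun !comp_lfunE. Qed.

Lemma conj_lfun_equivalent (S' : {vspace 'Hom(U', V')}) :
  bijective F -> bijective G -> equivalent (conj_lfun @: S')%VS S'.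
Proof.
move=> Fb Gb; exists F, G; split=> // f; split=> [/memv_imgP[g gS ->]|[g gS ->]].
  by exists g => //; rewrite lfunE.
have -> : (G \o g \o F)%VF = conj_lfun g by rewrite /conj_lfun (lfunE conj_fun).
exact: memv_img.
Qed.

Lemma equivalent_conj (S : {vspace 'Hom(U, V)}) (S' : {vspace 'Hom(U', V')}) :
  (forall f, f \in S <-> exists2 g, g \in S' & f = (G \o g \o F)%VF) ->
  S = (conj_lfun @: S')%VS.
Proof.
move=> SS'; apply/vspaceP => f; apply/idP/memv_imgP => [/SS'[g gS ->]|[g gS ->]].
  by exists g => //; rewrite lfunE.
by apply/SS'; exists g => //; rewrite lfunE.
Qed.

Hypotheses (Fb : bijective F) (Gb : bijective G).

Lemma conj_lfun_ker0 : lker conj_lfun == 0%VS.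
Proof.
have [F1 FK KF] := Fb; rewrite -subv0; apply/subvP => g; rewrite memv_ker memv0.
move/eqP => g0; apply/eqP/lfunP => w; apply: (bij_inj Gb).
by rewrite -[w]KF -conj_lfunE g0 !zero_lfunE linear0.
Qed.

Lemma dim_conj (S' : {vspace 'Hom(U', V')}) :
  \dim (conj_lfun @: S')%VS = \dim S'.
Proof. by rewrite limg_dim_eq // (eqP conj_lfun_ker0) capv0. Qed.

End Conjugation.

Lemma equivalent_dim (K : fieldType) (U V U' V' : vectType K)
    (S : {vspace 'Hom(U, V)}) (S' : {vspace 'Hom(U', V')}) :
  equivalent S S' -> \dim S = \dim S'.
Proof.
by case=> F [G [Fb Gb /equivalent_conj ->]]; rewrite dim_conj.
Qed.

Lemma equivalent_join (K : fieldType) (U V U' V' U'' V'' : vectType K)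
    (S : {vspace 'Hom(U, V)}) (S' : {vspace 'Hom(U', V')})
    (S'' : {vspace 'Hom(U'', V'')}) :
  equivalent S S' -> equivalent S S'' -> equivalent S' S''.
Proof.
move=> [F [G [Fb Gb SS']]] [F' [G' [Fb' Gb' SS'']]].
have [FK KF] := bijective_inv_lfun Fb; have [GK KG] := bijective_inv_lfun Gb.
have Fi : bijective (F^-1)%VF by exists F.
have Gi : bijective (G^-1)%VF by exists G.
exists (F' \o F^-1)%VF, (G^-1 \o G')%VF; split.
- apply: (eq_bij (bij_comp Fb' Fi)) => u; by rewrite comp_lfunE.
- apply: (eq_bij (bij_comp Gi Gb')) => u; by rewrite comp_lfunE.
move=> f; split=> [fS|[g gS fE]].
  have /SS''[g gS gE] : (G \o f \o F)%VF \in S by apply/SS'; exists f.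
  exists g => //; apply/lfunP => u; rewrite !comp_lfunE.
  have := congr1 (fun h : 'Hom(_, _) => (G^-1)%VF (h ((F^-1)%VF u))) gE.
  by rewrite !comp_lfunE GK KF.
have /SS'[f' f'S f'E] : (G' \o g \o F')%VF \in S by apply/SS''; exists g.
suff -> : f = f' by [].
apply/lfunP => u; rewrite fE !comp_lfunE.
have := congr1 (fun h : 'Hom(_, _) => (G^-1)%VF (h ((F^-1)%VF u))) f'E.
by rewrite !comp_lfunE GK KF.
Qed.

Section TwistedFacts.
Local Open Scope ring_scope.
Variables (K : fieldType) (A : LDBAlgebra K).
Implicit Types (x y z : A) (l m : K).

Local Notation "x ⋆ y" := (ldb_star x y) (at level 40).
Local Notation "x • y" := (ldb_bullet x y) (at level 40).

Lemma ldb_star_eq0 x y : x ⋆ y = 0 -> x = 0 \/ y = 0.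
Proof.
have [->|x0] := eqVneq x 0; first by left.
have [->|y0] := eqVneq y 0; first by right.
by move=> /eqP; rewrite (negPf (ldb_star_regular x0 y0)).
Qed.

(** For [x != 0], both sides agree after left multiplication by [x], which is injective. *)
Lemma ldb_bullet_star x z : x • (x ⋆ z) = ldb_qform x *: z.
Proof.
have [->|x0] := eqVneq x 0.
  rewrite linear0l; have [->|z0] := eqVneq z 0; first by rewrite scaler0.
  have := ldb_qformP (0 : A) z; rewrite linear0l => /esym/eqP.
  by rewrite scaler_eq0 (negPf z0) orbF => /eqP ->; rewrite scale0r.
apply/eqP; rewrite -subr_eq0; apply/eqP.
have : x ⋆ (x • (x ⋆ z) - ldb_qform x *: z) = 0.
  by rewrite linearB linearZ /= ldb_qformP subrr.
by case/ldb_star_eq0 => // x0'; rewrite x0' eqxx in x0.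
Qed.

Lemma ldb_qform_eq0 x : ldb_qform x = 0 -> x = 0.
Proof.
move=> qx; have v0 := ldb_vpick_neq0 A; set v := vpick _ in v0.
have := ldb_qformP x v; rewrite qx scale0r => /ldb_star_eq0[//|].
by case/(ldb_bullet_qli A).1 => // v0'; rewrite v0' eqxx in v0.
Qed.

Lemma ldb_qform0 : ldb_qform (0 : A) = 0.
Proof.
have v0 := ldb_vpick_neq0 A; have := ldb_qformP (0 : A) (vpick {:A}).
rewrite linear0l => /esym/eqP.
by rewrite scaler_eq0 (negPf v0) orbF => /eqP.
Qed.

(** Applying [x •] to the first coordinate and using the second one gives (q(x) - l m) z = 0: the
    twisted quadratic form acts as a determinant. *)
Lemma twisted_inj x l m (w : A * A) :
  ldb_qform x != (l * m) -> twisted_op x l m w = 0 -> w = 0.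
Proof.
case: w => y z; rewrite twisted_opE => qlm [E1 E2].
have z0 : z = 0.
  have : (ldb_qform x - l * m) *: z = 0.
    rewrite scalerBl -ldb_bullet_star -scalerA.
    move/eqP: E1; rewrite addr_eq0 => /eqP ->.
    by rewrite linearN linearZ /= -opprD -scalerDr E2 scaler0 oppr0.
  by move/eqP; rewrite scaler_eq0 subr_eq0 (negPf qlm) => /eqP.
move: E1 E2; rewrite z0 linear0r add0r scaler0 addr0 => /eqP.
rewrite scaler_eq0 => /orP[/eqP l0|/eqP -> //].
case/(ldb_bullet_qli A).1 => [x0|-> //].
by move: qlm; rewrite x0 l0 mul0r ldb_qform0 eqxx.
Qed.

Lemma twisted_singular x l m :
  ldb_qform x = (l * m) -> exists2 w : A * A, w != 0 & twisted_op x l m w = 0.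
Proof.
have v0 := ldb_vpick_neq0 A; set v := vpick _ in v0 => qlm.
have w0 y z : (y != 0) || (z != 0) -> ((y, z) : A * A) != 0.
  by apply: contraL => /eqP[-> ->]; rewrite eqxx.
have [l0|l0] := eqVneq l 0.
  have x0 : x = 0 by apply: ldb_qform_eq0; rewrite qlm l0 mul0r.
  exists (v, 0); first by rewrite w0 ?v0.
  by rewrite twisted_opE x0 l0 !linear0l scale0r scaler0 !addr0.
(* The first coordinate solves [x ⋆ v + l *: y = 0]; the second equation then holds because q(x) = l
   m. *)
exists (- l^-1 *: (x ⋆ v), v); first by rewrite w0 ?v0 ?orbT.
rewrite twisted_opE [_ • _]linearZ /= ldb_bullet_star qlm !scalerA !mulrN divff //.
by rewrite !mulNr mulrA mulVf // !scaleNr mul1r scale1r subrr addNr.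
Qed.

Lemma twisted_op0 : twisted_op (0 : A) 0 0 = 0.
Proof.
apply/lfunP => -[y z].
by rewrite twisted_opE zero_lfunE !linear0l !scale0r !addr0.
Qed.

Lemma twisted_neq0 x l m : (x != 0) || (l != 0) || (m != 0) ->
  twisted_op x l m != 0.
Proof.
by rewrite -twisted_op0; apply: contraL => /eqP /twisted_op_inj[-> -> ->]; rewrite !eqxx.
Qed.

Lemma twisted_memv x l m : twisted_op x l m \in twisted_space A.
Proof. by apply/twisted_spaceP; exists x, l, m. Qed.

Lemma linfun_twisted w : linfun (@twisted_map K A) w = twisted_map w.
Proof. exact: lfunE. Qed.

Lemma twisted_LLD : LLD (twisted_space A).
Proof.
case=> y z; have [->|y0] := eqVneq y 0.
  exists (twisted_op 0 1 0); rewrite twisted_memv twisted_neq0 ?oner_eq0 ?orbT //.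
  by split=> //; rewrite twisted_opE !linear0l scaler0 scale0r addr0.
have [->|z0] := eqVneq z 0.
  exists (twisted_op 0 0 1); rewrite twisted_memv twisted_neq0 ?oner_eq0 ?orbT //.
  by split=> //; rewrite twisted_opE !linear0l scaler0 scale0r addr0.
have [s sE] : exists s : 'Hom(A, A), s =1 (fun x => x ⋆ z).
  by apply: linear_lfun => c a b; rewrite linearPl.
have s_inj : bijective s.
  apply: lfun_bijective => // u; rewrite sE => /ldb_star_eq0[//|z0'].
  by rewrite z0' eqxx in z0.
have [_ sK] := bijective_inv_lfun s_inj.
(* Solve [x ⋆ z = y]; then [x • y = ldb_qform x *: z], which dictates the two scalars of the
   witness. *)
have := sK y; set x := (s^-1)%VF y; rewrite sE => xz.
exists (twisted_op x (- 1) (- ldb_qform x)).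
rewrite twisted_memv twisted_neq0 ?oppr_eq0 ?oner_eq0 ?orbT //; split=> //.
by rewrite twisted_opE xz -xz ldb_bullet_star scaleN1r scaleNr !subrr.
Qed.

Lemma twisted_id w : twisted_op (0 : A) 1 1 w = w.
Proof. by case: w => y z; rewrite twisted_opE !linear0l !add0r !scale1r. Qed.

Lemma twisted_dim : \dim (twisted_space A) = (\dim {:A}).+2.
Proof.
rewrite /twisted_space limg_dim_eq; last first.
  apply/eqP; rewrite -subv0; apply/subvP => -[x [l m]].
  rewrite memv_cap memv_ker memv0 lfunE /= /twisted_map /= => /andP[_].
  apply: contraTT => w0; apply: twisted_neq0; apply: contraTT w0.
  by rewrite -!orbA !negb_or !negbK => /and3P[/eqP -> /eqP -> /eqP ->].
by rewrite !dimvf -addn2.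
Qed.

End TwistedFacts.

(** * Uniqueness up to weak equivalence *)

Section WeakEquivalence.
Local Open Scope ring_scope.
Variable K : fieldType.

Local Notation "x ⋆ y" := (ldb_star x y) (at level 40).
Local Notation "x • y" := (ldb_bullet x y) (at level 40).

Lemma ldb_star_lfun (A : LDBAlgebra K) (x : A) : x != 0 ->
  exists L : 'Hom(A, A), bijective L /\ L =1 ldb_star x.
Proof.
move=> x0; have [L LE] : exists L : 'Hom(A, A), L =1 ldb_star x.
  by apply: linear_lfun => c y z; rewrite linearPr.
exists L; split=> //; apply: lfun_bijective => // u; rewrite LE.
by case/ldb_star_eq0 => // x0'; rewrite x0' eqxx in x0.
Qed.

(** With equal dimensions, regularity of the two products makes the three maps bijective. *)
Lemma weakly_equivalent_of_factor (A B : LDBAlgebra K)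
    (f g : 'Hom(B, A)) (h : 'Hom(A, B)) :
  \dim {:A} = \dim {:B} -> (forall x y : B, x ⋆ y = h (f x ⋆ g y)) ->
  weakly_equivalent A B.
Proof.
move=> dAB E; have v0 := ldb_vpick_neq0 B; set v := vpick _ in v0.
have fb : bijective f.
  apply: lfun_bijective => // u fu; have := E u v.
  rewrite fu linear0l linear0 => /ldb_star_eq0[//|v0'].
  by rewrite v0' eqxx in v0.
have gb : bijective g.
  apply: lfun_bijective => // u gu; have := E v u.
  rewrite gu linear0r linear0 => /ldb_star_eq0[v0'|//].
  by rewrite v0' eqxx in v0.
exists f, g, h; split=> //; apply: lfun_bijective => // a ha.
have fv0 : f v != 0.
  by apply: contraNneq v0 => fv; rewrite -(inj_eq (bij_inj fb)) fv linear0.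
have [L [Lb LE]] := ldb_star_lfun fv0.
have [L' _ LK] := Lb; have [g' _ gK] := gb.
have := E v (g' (L' a)); rewrite gK -LE LK ha => /ldb_star_eq0[v0'|g0].
  by rewrite v0' eqxx in v0.
by rewrite -[a]LK -[L' a]gK g0 linear0 LE linear0r.
Qed.

Lemma ldb_polarized (A : LDBAlgebra K) (x x' y : A) :
  x ⋆ (x' • y) + x' ⋆ (x • y) = (ldb_polar x x' + ldb_polar x' x) *: y.
Proof.
have := ldb_qformP (x + x') y.
have -> : ldb_qform (x + x') =
    ldb_qform x + ldb_qform x' + (ldb_polar x x' + ldb_polar x' x).
  by rewrite /ldb_qform /ldb_polar !linearDl !linearDr /= !linearD /=; ring.
rewrite !linearDl !linearDr /= !ldb_qformP !scalerDl => E.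
apply: (addrI (ldb_qform x *: y + ldb_qform x' *: y)).
by rewrite -E [RHS](AC (2*2) ((1*4)*(3*2))) [X in _ + X]addrC.
Qed.

(* Polarizing x1 * (x1 . y) = q(x1) y: up to a factor -1, s is the reflection along x1. *)
Lemma ldb_bullet_isotopy (A : LDBAlgebra K) (x1 : A) : x1 != 0 ->
  exists s : 'Hom(A, A), forall x y, x1 ⋆ (x • y) = s x ⋆ (x1 • y).
Proof.
move=> x0; have q0 : ldb_qform x1 != 0.
  by apply: contraNneq x0 => /ldb_qform_eq0 ->.
have [s sE] : exists s : 'Hom(A, A), s =1 (fun x =>
    ((ldb_polar x1 x + ldb_polar x x1) / ldb_qform x1) *: x1 - x).
  apply: linear_lfun => c x y; rewrite linearPr linearPl /= scalerBr scalerA.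
  rewrite opprD [RHS]addrACA -scalerDl; congr (_ *: _ + _).
  by field.
exists s => x y; apply: (addIr (x ⋆ (x1 • y))).
rewrite ldb_polarized sE linearBl linearZl_LR /= ldb_qformP subrK scalerA.
by rewrite divfK.
Qed.

Lemma weakly_equivalent_twisted (A B : LDBAlgebra K) :
  equivalent (twisted_space B) (twisted_space A) -> weakly_equivalent A B.
Proof.
move=> TT; have := equivalent_dim TT; rewrite !twisted_dim => -[] /esym dAB.
have [F [G [Fb Gb /equivalent_conj TE]]] := TT.
have [FK KF] := bijective_inv_lfun Fb; have [GK KG] := bijective_inv_lfun Gb.
(* [P] is the equivalence read on the parameters (x, (l, m)) of the two operator spaces. *)
have [P PE] : exists P : 'Hom((B * (K^o * K^o))%type, (A * (K^o * K^o))%type),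
    forall w p, twisted_map w p = G (twisted_map (P w) (F p)).
  exists ((linfun (@twisted_map K A))^-1 \o (conj_lfun F G)^-1 \o
            linfun (@twisted_map K B))%VF => w p.
  have : linfun (@twisted_map K B) w \in twisted_space B.
    by rewrite memv_img ?memvf.
  rewrite TE => /memv_imgP[g gT wE]; rewrite -conj_lfunE !comp_lfunE wE.
  rewrite (lker0_lfunK (conj_lfun_ker0 Fb Gb)).
  have gE : twisted_map ((linfun (@twisted_map K A))^-1%VF g) = g.
    by rewrite -linfun_twisted limg_lfunVK.
  by rewrite gE -wE linfun_twisted.
(* c0 represents the operator of T_A that corresponds to (y, z) |-> (y, 0). *)
case c0E : (P (0, (1, 0))) => [x0 [l0 m0]].
have c0P (y : B) z : G (twisted_op x0 l0 m0 (F (y, z))) = (y, 0).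
  have := PE (0, (1, 0)) (y, z); rewrite c0E /twisted_map /= => <-.
  by rewrite twisted_opE !linear0l scale1r scale0r !add0r.
have kill z : twisted_op x0 l0 m0 (F (0, z)) = 0.
  by apply: (bij_inj Gb); rewrite c0P linear0.
have v0 := ldb_vpick_neq0 B; set v := vpick _ in v0.
have q0 : ldb_qform x0 = l0 * m0.
  apply/eqP; apply: contraT => /twisted_inj/(_ (kill v)) Fv.
  by have := FK (0, v); rewrite Fv linear0 => -[v0']; rewrite -v0' eqxx in v0.
have pairP c (y z : B) : (0, c *: y + z) = c *: (0, y) + (0, z) :> B * B.
  by apply/pair_equal_spec; split; rewrite //= scaler0 addr0.
have injP c (y z : B) :
    (c *: y + z, (0, 0)) = c *: (y, (0, 0)) + (z, (0, 0)) :> B * (K^o * K^o).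
  by apply/pair_equal_spec; split=> //; apply/pair_equal_spec;
     split; rewrite /= scaler0 addr0.
have starE (x z : B) :
    (x ⋆ z, 0) = G (twisted_map (P (x, (0, 0))) (F (0, z))) :> B * B.
  by rewrite -PE /twisted_map /= twisted_opE !scale0r linear0r !addr0.
have in_img (x z : B) : exists w : A * A,
    twisted_map (P (x, (0, 0))) (F (0, z)) = twisted_op x0 l0 m0 w.
  exists (F (x ⋆ z, 0)); apply: (bij_inj Gb).
  by rewrite -starE c0P.
(* If [l0 != 0], vectors of the kernel of [twisted_op x0 l0 m0] are determined by their second
   coordinate and those of its image by their first. Subtracting the multiple [l / l0] of this
   operator, which does not change values on the kernel, removes the parameter [l] and leaves a
   product [⋆] of [A]. *)
have [l00|l00] := eqVneq l0 0; last first.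
  have [theta thetaE] : exists t : 'Hom(B, A), t =1 fun x =>
      (P (x, (0, 0))).1 - ((P (x, (0, 0))).2.1 / l0) *: x0.
    apply: linear_lfun => c y z; rewrite injP linearP /=.
    by rewrite mulrDl scalerDl opprD -mulrA scalerBr scalerA addrACA.
  have [rho rhoE] : exists r : 'Hom(B, A), r =1 fun z => (F (0, z)).2.
    by apply: linear_lfun => c y z; rewrite pairP linearP.
  have [h hE] : exists h : 'Hom(A, B), h =1 fun w => (G (w, l0^-1 *: (x0 • w))).1.
    apply: linear_lfun => c y z; rewrite -[RHS]/((c *: _ + _).1) -linearP.
    congr (G _).1; apply/pair_equal_spec; split=> //=.
    by rewrite linearPr scalerDr !scalerA mulrC.
  apply: (@weakly_equivalent_of_factor A B theta rho h dAB) => x z.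
  rewrite hE thetaE rhoE; have := starE x z; have [[y' z'] wE] := in_img x z.
  have := kill z; move: wE; rewrite /twisted_map.
  case: (P _) => a [l m] /=; case: (F (0, z)) => y r /=.
  rewrite !twisted_opE => -[w1 w2] [k1 _] /(congr1 fst) /= ->.
  have w1E : (a - (l / l0) *: x0) ⋆ r = a ⋆ r + l *: y.
    rewrite linearBl linearZl_LR /=.
    move/eqP: k1; rewrite addr_eq0 => /eqP ->.
    by rewrite scalerN opprK scalerA divfK.
  rewrite w1E; congr (G (_, _)).1.
  have -> : x0 • (a ⋆ r + l *: y) = l0 *: (x0 • y' + m0 *: z').
    rewrite w1 linearDr linearZr_LR /= ldb_bullet_star q0.
    by rewrite scalerDr scalerA addrC.
  by rewrite scalerA mulVf // scale1r w2.
(* Now the operator is (y, z) |-> (0, m0 z), with kernel A x 0 and image 0 x A. The recovered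
   product is [•], which [ldb_bullet_isotopy] converts into [⋆]. *)
have x00 : x0 = 0 by apply: ldb_qform_eq0; rewrite q0 l00 mul0r.
have m00 : m0 != 0.
  apply: contraNneq v0 => m00; have := c0P v 0.
  by rewrite x00 l00 m00 twisted_op0 zero_lfunE linear0 => -[<-].
have v1 := ldb_vpick_neq0 A; set x1 := vpick _ in v1.
have [s sE] := ldb_bullet_isotopy v1; have [L [Lb LE]] := ldb_star_lfun v1.
have [LK KL] := bijective_inv_lfun Lb.
have [theta thetaE] : exists t : 'Hom(B, A), t =1 fun x => (P (x, (0, 0))).1.
  by apply: linear_lfun => c y z; rewrite injP linearP.
have [rho rhoE] : exists r : 'Hom(B, A), r =1 fun z => x1 • (F (0, z)).1.
  by apply: linear_lfun => c y z; rewrite pairP linearP /= linearPr.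
have [h hE] : exists h : 'Hom(A, B), h =1 fun w => (G (0, w)).1.
  apply: linear_lfun => c y z; rewrite -[RHS]/((c *: _ + _).1) -linearP.
  by congr (G _).1; apply/pair_equal_spec; split; rewrite //= scaler0 addr0.
apply: (@weakly_equivalent_of_factor A B (s \o theta)%VF rho (h \o L^-1)%VF dAB).
move=> x z; rewrite !comp_lfunE rhoE -sE -LE LK thetaE hE.
have := starE x z; have [[y' z'] wE] := in_img x z.
have := kill z; move: wE; rewrite /twisted_map.
case: (P _) => a [l m] /=; case: (F (0, z)) => y r /=.
rewrite !twisted_opE x00 l00 !linear0l !scale0r !add0r.
move=> -[-> _] /(congr1 snd)/= /eqP; rewrite scaler_eq0 (negPf m00) /= => /eqP ->.
by rewrite scaler0 addr0 => /(congr1 fst).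
Qed.

End WeakEquivalence.

(** * Reflexive closure *)

Section ReflexiveClosure.
Local Open Scope ring_scope.
Variables (K : fieldType) (U V : vectType K) (n : nat).
Variable H : {vspace 'Hom(U, V)}.
Implicit Types (S : {vspace 'Hom(U, V)}).

Lemma special_rank S f : extremal n S H -> special n S f -> lrank f = n.-1.
Proof.
move=> SH sf; have [fS f0 _] := sf.
have /lfunPn[y] := f0; rewrite zero_lfunE => fy.
have y0 : y != 0 by apply: contraNneq fy => ->; rewrite linear0.
have [g sg gy] := generic_special SH (generic_neq0 SH y0).
have fg : f \notin <[g]>%VS.
  by apply: contra fy => /vlineP[c ->]; rewrite scale_lfunE gy scaler0.
by have [] := special_pairP SH sf sg fg.
Qed.

Lemma extremal_subclosure S f :
  extremal n S H -> f \in S -> in_reflexive_closure H f.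
Proof.
move=> SH fS x.
by have := mem_values x fS; rewrite (values_hyperplaneE SH) => /valuesP.
Qed.

(** Reduces the reflexive closure to a comparison of two extensions of [H]: local dependence holds
    because [g - h] kills [x] when [g x = h x], and a bijective operator of [H] gives
    reducedness. *)
Lemma extremal_closure_extension S g : extremal n S H ->
  in_reflexive_closure H g -> g \notin H -> extremal n (H + <[g]>)%VS H.
Proof.
move=> SH gcl gH; have n3 := extremal_n SH; have dH := extremal_dimH SH.
have [k kH k0] : exists2 k, k \in H & k != 0.
  exists (vpick H); first exact: memv_pick.
  by rewrite vpick0 -dimv_eq0 dH; lia.
have kb : bijective k.
  apply: lfun_bijective; last by rewrite (extremal_dimU SH) (extremal_dimV SH).
  by move=> u; apply: (extremal_inj SH).
have sub_H f : f \in H -> f \in (H + <[g]>)%VS.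
  exact: (subvP (addvSl _ _)).
have gS : g \in (H + <[g]>)%VS by rewrite (subvP (addvSr _ _)) ?memv_line.
have dS : \dim (H + <[g]>) = n.+1.
  rewrite dimv_disjoint_sum ?dim_vline ?dH.
    by have [g0|_] := eqVneq g 0; [rewrite g0 mem0v in gH | rewrite addn1].
  exact: capv_line.
split=> //; first exact: extremal_card SH.
- split=> [x xS|v]; first by apply: (extremal_inj SH kH k0); apply/xS/sub_H.
  have [_ kK] := bijective_inv_lfun kb.
  exists [:: (k, (k^-1)%VF v)]; split=> [p|]; last by rewrite big_seq1 /= kK.
  by rewrite inE => /eqP ->; apply: sub_H.
- move=> x; have [h hH gx] := gcl x; exists (g - h).
  split; first by rewrite memvB ?(sub_H h).
    by apply: contra gH; rewrite subr_eq0 => /eqP ->.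
  by rewrite add_lfunE opp_lfunE gx subrr.
- by rewrite /hyperplane_of addvSl dS dH eqxx.
exact: extremal_rank SH.
Qed.

(** * Two extensions of the same hyperplane *)

Section TwoExtensions.
Variables S S1 : {vspace 'Hom(U, V)}.
Hypotheses (n4 : (4 <= n)%N) (SH : extremal n S H) (SH1 : extremal n S1 H).

Let limg_values S' f x : extremal n S' H -> x != 0 -> f \in S' -> f x = 0 ->
  (limg f <= values H x)%VS.
Proof.
move=> SH' x0 fS fx; rewrite -(values_hyperplaneE SH').
exact: (limg_sub_values SH' (generic_neq0 SH' x0)).
Qed.

Lemma limg_meet x f f1 : x != 0 -> f \in S -> f1 \in S1 -> f != 0 -> f1 != 0 ->
  f x = 0 -> f1 x = 0 -> (n - 2 <= \dim (limg f :&: limg f1))%N.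
Proof.
move=> x0 fS f1S f0 f10 fx f1x.
have rf := special_rank SH (special_killing SH x0 fS f0 fx).
have rf1 := special_rank SH1 (special_killing SH1 x0 f1S f10 f1x).
have : (limg f + limg f1 <= values H x)%VS.
  by rewrite subv_add (limg_values SH) ?(limg_values SH1).
move/dimvS; rewrite (values_hyperplane SH x0).
have := dimv_sum_cap (limg f) (limg f1).
by move: rf rf1; rewrite /lrank => -> ->; clear -n4; lia.
Qed.

(** If [f y = 0] but [f1 y != 0], some special [f2] of [S1] kills [y], and im f1, im f2 meet
    trivially. Each meets im f in dimension at least [n - 2], so 2(n - 2) <= n - 1, against
    [n >= 4]. *)
Lemma lker_eq x f f1 : x != 0 -> f \in S -> f1 \in S1 -> f != 0 -> f1 != 0 ->
  f x = 0 -> f1 x = 0 -> lker f = lker f1.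
Proof.
move=> x0 fS f1S f0 f10 fx f1x.
have sf := special_killing SH x0 fS f0 fx; have rf := special_rank SH sf.
have sf1 := special_killing SH1 x0 f1S f10 f1x.
have rf1 := special_rank SH1 sf1.
apply/eqP; rewrite eqEdim; apply/andP; split; last first.
  have := dim_lker f; rewrite -(dim_lker f1) rf rf1 => /eqP.
  by rewrite eqn_add2r => /eqP ->.
apply/subvP => y; rewrite !memv_ker => /eqP fy; apply: contraT => f1y.
have y0 : y != 0 by apply: contraNneq f1y => ->; rewrite linear0.
have [f2 sf2 f2y] := generic_special SH1 (generic_neq0 SH1 y0).
have [f2S f20 _] := sf2.
have f12 : f1 \notin <[f2]>%VS.
  by apply: contra f1y => /vlineP[c ->]; rewrite scale_lfunE f2y scaler0.
have [_ _ dis _] := special_pairP SH1 sf1 sf2 f12.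
have := limg_meet x0 fS f1S f0 f10 fx f1x.
have := limg_meet y0 fS f2S f0 f20 fy f2y.
have := dimv_sum_cap (limg f :&: limg f1) (limg f :&: limg f2).
have -> : (limg f :&: limg f1 :&: (limg f :&: limg f2))%VS = 0%VS.
  apply/eqP; rewrite -subv0 -dis.
  by rewrite capvS // capvSr.
have : (limg f :&: limg f1 + limg f :&: limg f2 <= limg f)%VS.
  by rewrite subv_add !capvSl.
move/dimvS; move: rf; rewrite /lrank dimv0 => ->; clear -n4; lia.
Qed.

(** Independent special [f1], [f2] of [S] are matched with [g1], [g2] of [S1] having the same
    kernels. Decomposing a combination [g1 - c *: g2] of [H] along [f1], [f2] shows that [g1] is a
    multiple of [f1]. *)
Lemma extremal_extension_meet : exists2 g, g \in S1 & (g \in S) && (g \notin H).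
Proof.
have [f1 [f2 [sf1 sf2 f12]]] := exists_special_pair SH.
have pick f : special n S f -> exists x g,
    [/\ x != 0, f x = 0, special n S1 g & g x = 0].
  case=> fS f0 [x gx fx].
  have x0 : x != 0.
    apply/eqP => x0; have := extremal_n SH; rewrite -gx /values x0.
    have -> : linfun (eval_at (0 : U)) = 0 :> 'Hom('Hom(U, V), V).
      by apply/lfunP => h; rewrite lfunE /= /eval_at linear0 zero_lfunE.
    by rewrite lim0g dimv0.
  have [g sg gx0] := generic_special SH1 (generic_neq0 SH1 x0).
  by exists x, g.
have [x1 [g1 [x10 f1x sg1 g1x]]] := pick _ sf1.
have [x2 [g2 [x20 f2x sg2 g2x]]] := pick _ sf2.
have [f1S f10 _] := sf1; have [f2S f20 _] := sf2.
have [g1S g10 _] := sg1; have [g2S g20 _] := sg2.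
have k1 := lker_eq x10 f1S g1S f10 g10 f1x g1x.
have k2 := lker_eq x20 f2S g2S f20 g20 f2x g2x.
have ker1 y : f1 y = 0 -> g1 y = 0.
  by move/eqP; rewrite -memv_ker k1 memv_ker => /eqP.
have ker2 y : f2 y = 0 -> g2 y = 0.
  by move/eqP; rewrite -memv_ker k2 memv_ker => /eqP.
have [c hH] := hyperplane_combine SH1 g1S g2S (special_notin SH1 sg2).
have hS := subvP (extremal_sub SH) _ hH; set h := g1 - c *: g2 in hH hS.
have hE u : h u = g1 u - c *: g2 u by rewrite add_lfunE opp_lfunE scale_lfunE.
have [s [d' [d [sD hsE]]]] := off_diagonal_decomp SH sf1 sf2 f12 hS.
have [sS sD1 sD2] := (off_diagonalP SH sf1 sf2 f12 s).1 sD.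
have hE' u : h u = s u + d' *: f1 u + d *: f2 u.
  by rewrite hsE !add_lfunE !scale_lfunE.
(* Take a nonzero [v = g2 y] in im f2 meet im g2, with [y] in ker f1. Then [s y] is a combination of
   [v] and [f2 y], so it lies in im f1 and in im f2 and vanishes; if [s] were nonzero, [y] would be
   0. *)
have s0 : s = 0.
  apply/eqP; apply: contraT => s0.
  have v0 : vpick (limg f2 :&: limg g2)%VS != 0.
    rewrite vpick0 -dimv_eq0.
    by have := limg_meet x20 f2S g2S f20 g20 f2x g2x; clear -n4; lia.
  have := memv_pick (limg f2 :&: limg g2)%VS; set v := vpick _ in v0 *.
  case/memv_capP => vf /memv_imgP[u _ vE].
  have [y [u2 [f1y f2u uE]]] := special_decomp SH sf1 sf2 f12 u.
  have vy : v = g2 y by rewrite vE uE linearD /= (ker2 _ f2u) addr0.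
  have sy : s y = 0.
    apply: (special_disjoint SH sf1 sf2 f12); first exact: sD1.
    have := hE y; rewrite hE' f1y (ker1 _ f1y) scaler0 addr0 sub0r => dE.
    have -> : s y = - (c *: v) - d *: f2 y by rewrite vy -dE addrK.
    by rewrite memvB ?memvN ?memvZ ?memv_img ?memvf.
  have y0 := off_diagonal_injl SH sf1 sf2 f12 sD s0 f1y sy.
  by rewrite vy y0 linear0 eqxx in v0.
suff g1E : g1 = d' *: f1.
  by exists g1 => //; rewrite (special_notin SH1 sg1) andbT g1E memvZ.
apply/lfunP => u; have [u1 [u2 [fu1 fu2 ->]]] := special_decomp SH sf1 sf2 f12 u.
rewrite scale_lfunE !linearD /= fu1 (ker1 _ fu1) !add0r.
have := hE u2; rewrite hE' s0 zero_lfunE fu2 (ker2 _ fu2) !scaler0 subr0.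
by rewrite add0r addr0 => ->.
Qed.

End TwoExtensions.

Lemma extremal_reflexive_closure S : (4 <= n)%N -> extremal n S H ->
  is_reflexive_closure S H.
Proof.
move=> n4 SH g; split=> [|gcl]; first exact: extremal_subclosure.
have [gH|gH] := boolP (g \in H); first exact: (subvP (extremal_sub SH)).
have SH1 := extremal_closure_extension SH gcl gH.
have [g1 /memv_addP[h hH [_ /vlineP[c ->] g1E]] /andP[g1S g1H]] :=
  extremal_extension_meet n4 SH SH1.
have c0 : c != 0.
  by apply: contraNneq g1H => c0; rewrite g1E c0 scale0r addr0.
have -> : g = c^-1 *: (g1 - h).
  by rewrite g1E addrC addKr scalerA mulVf // scale1r.
by rewrite memvZ // memvB // (subvP (extremal_sub SH)).
Qed.

End ReflexiveClosure.

(** * Correspondence with non-isotropic hyperplanes of twisted operator spaces *)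

Section Hyperplanes.
Local Open Scope ring_scope.
Variables (K : fieldType) (U V : vectType K) (n : nat).
Variables (S H : {vspace 'Hom(U, V)}).
Hypothesis SH : extremal n S H.

(** Isotropic vectors of the twisted space are non-injective by [twisted_singular], whereas nonzero
    operators of [H] are injective. *)
Lemma extremal_hyperplane_twisted (A : LDBAlgebra K) :
  equivalent S (twisted_space A) -> equiv_non_isotropic_hyperplane H A.
Proof.
case=> F [G [Fb Gb /equivalent_conj SE]].
pose H' := (twisted_space A :&: conj_lfun F G @^-1: H)%VS.
have HE : H = (conj_lfun F G @: H')%VS.
  apply/vspaceP => h; apply/idP/memv_imgP => [hH|[t /memv_capP[_ tH] ->]].
    have := subvP (extremal_sub SH) _ hH; rewrite SE => /memv_imgP[t tT hE].
    by exists t => //; rewrite memv_cap tT -memv_preim -hE.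
  by rewrite memv_preim.
exists H'; split.
- rewrite /hyperplane_of capvSl /= -(dim_conj Fb Gb (twisted_space A)) -SE.
  by rewrite -(dim_conj Fb Gb H') -HE; case/andP: (extremal_hyperplane SH).
- move=> x l m tH t0; apply/negP; rewrite subr_eq0 => /eqP.
  case/twisted_singular => w w0 tw; case/negP: w0; apply/eqP.
  have [F1 FK F1K] := Fb.
  rewrite -[w]F1K -(linear0 F); congr (F _).
  apply: (extremal_inj SH (h := conj_lfun F G (twisted_op x l m))).
  + by rewrite HE memv_img.
  + apply: contraNneq t0 => E; apply/eqP/(lker0P (conj_lfun_ker0 Fb Gb)).
    by rewrite E linear0.
  by rewrite conj_lfunE F1K tw linear0.
by rewrite HE; apply: conj_lfun_equivalent.
Qed.

(** The equivalence of [H] with a hyperplane carries the whole twisted space to an extension of [H];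
    it is reduced because the twisted space contains the identity. *)
Lemma extremal_from_twisted (A : LDBAlgebra K) :
  equiv_non_isotropic_hyperplane H A ->
  exists2 S' : {vspace 'Hom(U, V)}, extremal n S' H &
    equivalent S' (twisted_space A).
Proof.
case=> H' [/andP[H'T /eqP dT] _ [F [G [Fb Gb /equivalent_conj HE]]]].
have dH : \dim H' = n by rewrite -(dim_conj Fb Gb) -HE (extremal_dimH SH).
have [F1 FK F1K] := Fb; have [G1 GK G1K] := Gb.
exists (conj_lfun F G @: twisted_space A)%VS; last exact: conj_lfun_equivalent.
have dS : \dim (conj_lfun F G @: twisted_space A) = n.+1 by rewrite dim_conj // dT dH.
split=> //; [exact: extremal_n SH | exact: extremal_card SH | | | |].
- split=> [x xS|v].
    have := xS _ (memv_img (conj_lfun F G) (twisted_memv (0 : A) 1 1)).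
    rewrite conj_lfunE twisted_id -(linear0 G) => /(can_inj GK).
    by rewrite -(linear0 F) => /(can_inj FK).
  exists [:: (conj_lfun F G (twisted_op (0 : A) 1 1), F1 (G1 v))].
  split=> [p|].
    by rewrite inE => /eqP -> /=; rewrite memv_img ?twisted_memv.
  by rewrite big_seq1 /= conj_lfunE twisted_id F1K G1K.
- move=> x; have [t [tT t0 tx]] := twisted_LLD (F x).
  exists (conj_lfun F G t); split; first exact: memv_img.
    apply: contraNneq t0 => E; apply/eqP/(lker0P (conj_lfun_ker0 Fb Gb)).
    by rewrite E linear0.
  by rewrite conj_lfunE tx linear0.
- by rewrite /hyperplane_of dS (extremal_dimH SH) eqxx HE limgS.
exact: extremal_rank SH.
Qed.

End Hyperplanes.

Theorem theorem6p1 (n : nat) (K : fieldType) (U V : vectType K)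
    (S H : {vspace 'Hom(U, V)})
    (hn : (3 <= n)%N) (hK : card_gt K n)
    (hdimS : \dim S = n.+1) (hred : reduced S) (hLLD : LLD S)
    (hH : hyperplane_of S H) (hmrk : has_mrk H (2 * n - 2)%N) :
  (* (a) *)
  (exists A : LDBAlgebra K,
     \dim {:ldb_sort A} = (n - 1)%N /\ equivalent S (twisted_space A)) /\
  (* (b) *)
  (forall A B : LDBAlgebra K,
     equivalent S (twisted_space A) -> equivalent S (twisted_space B) ->
     weakly_equivalent A B) /\
  (* (c) *)
  (forall A : LDBAlgebra K, equivalent S (twisted_space A) ->
     equiv_non_isotropic_hyperplane H A) /\
  (* (d) *)
  ((4 <= n)%N ->
     [/\ is_reflexive_closure S H,
         (forall (S' : {vspace 'Hom(U, V)}) (A B : LDBAlgebra K),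
            \dim S' = n.+1 -> reduced S' -> LLD S' -> hyperplane_of S' H ->
            equivalent S (twisted_space A) ->
            equivalent S' (twisted_space B) ->
            weakly_equivalent A B)
       & (forall A B : LDBAlgebra K,
            equiv_non_isotropic_hyperplane H A ->
            equiv_non_isotropic_hyperplane H B ->
            weakly_equivalent A B)]).
Proof.
have SH : extremal n S H by split=> //; case: hmrk.
have uniq (T : {vspace 'Hom(U, V)}) (A B : LDBAlgebra K) :
    equivalent T (twisted_space A) -> equivalent T (twisted_space B) ->
    weakly_equivalent A B.
  move=> TA TB; apply: weakly_equivalent_twisted.
  exact: equivalent_join TB TA.
split; [|split; [exact: uniq | split; [exact: extremal_hyperplane_twisted SH|]]].
  have [f [g [sf sg fg]]] := exists_special_pair SH.
  by have := extremal_twisted SH sf sg fg; rewrite -subn1.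
move=> n4.
(* Both [T] and [S] are the reflexive closure of [H], so uniqueness for [S] becomes uniqueness for
   [H]. *)
have closure T : extremal n T H -> T = S.
  move=> TH; apply/vspaceP => f; apply/idP/idP.
    by move/(extremal_reflexive_closure n4 TH)/(extremal_reflexive_closure n4 SH).
  by move/(extremal_reflexive_closure n4 SH)/(extremal_reflexive_closure n4 TH).
split=> [|S' A B dS' rS' lS' hS' SA SB|A B HA HB].
- exact: extremal_reflexive_closure n4 SH.
- have S'H : extremal n S' H by split=> //; case: hmrk.
  by apply: uniq SA _; rewrite -(closure _ S'H).
have [SA SAH SAT] := extremal_from_twisted SH HA.
have [SB SBH SBT] := extremal_from_twisted SH HB.
apply: (uniq S); first by rewrite -(closure _ SAH).
by rewrite -(closure _ SBH).
Qed.
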